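(* Let $\Omega\subset\mathbb{R}^n$ be an open, bounded domain and let $\phi\in C^2(\Omega)\cap C^1(\overline{\Omega})$ be an eigenfunction, with eigenvalue $\lambda$, of the Dirichlet problem $$-\Delta\phi=\lambda\phi\ \text{ in }\Omega,\qquad\phi=0\ \text{ on }\partial\Omega.$$ Then $$\lambda\ge n\,|B_1|^{1/n}\,\frac{\inf_{\partial\Omega}|\nabla\phi|}{\|\phi\|_{L^n(\Omega)}}.$$
   Context: $B_1$ is the unit ball of $\mathbb{R}^n$ and $|B_1|$ its Lebesgue measure. An eigenfunction is a solution that is not identically zero. Throughout, $\Omega$ is assumed to have an outward unit normal $\nu$ on $\partial\Omega$. *)

(* Defs.v *)
From HB Require Import structures.
From mathcomp Require Import all_boot all_order all_algebra.
From mathcomp Require Import all_classical all_reals all_analysis.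

Set Implicit Arguments.
Unset Strict Implicit.
Unset Printing Implicit Defensive.

Import Order.TTheory GRing.Theory Num.Theory.
Import numFieldNormedType.Exports.

Local Open Scope classical_set_scope.
Local Open Scope ring_scope.

(* 'rV[R]_n carries the Borel sigma-algebra of R^n, as generated by the n
   coordinate maps (compare the library's instance for n.-tuple T). *)
Definition row_coord (R : realType) (n : nat) (i : 'I_n) (v : 'rV[R]_n) : R :=
  v ord0 i.

Definition row_display : measure_display.
Proof. exact: default_measure_display. Qed.

Section row_measurable.
Variables (R : realType) (n : nat).

Let row_set0 : g_sigma_preimage (@row_coord R n) set0.
Proof. exact: sigma_algebra0. Qed.

Let row_setC A : g_sigma_preimage (@row_coord R n) A ->
  g_sigma_preimage (@row_coord R n) (~` A).
Proof. exact: sigma_algebraC. Qed.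

Let row_bigcup (F : (set 'rV[R]_n)^nat) :
  (forall i, g_sigma_preimage (@row_coord R n) (F i)) ->
  g_sigma_preimage (@row_coord R n) (\bigcup_i (F i)).
Proof. exact: sigma_algebra_bigcup. Qed.

HB.instance Definition _ := @isMeasurable.Build row_display 'rV[R]_n
  (g_sigma_preimage (@row_coord R n)) row_set0 row_setC row_bigcup.

Lemma measurable_row_coord (i : 'I_n) :
  measurable_fun [set: 'rV[R]_n] (@row_coord R n i).
Proof.
move=> _ Y mY; apply: sub_sigma_algebra => /=.
rewrite -bigcup_seq/=; exists i => /=; first by rewrite mem_index_enum.
by exists Y.
Qed.

Lemma measurable_fun_row d (T : measurableType d) (f : T -> 'rV[R]_n) :
  (forall i, measurable_fun [set: T] (fun x => f x ord0 i)) ->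
  measurable_fun [set: T] f.
Proof.
move=> mf _ A mA; rewrite setTI.
suff : (@measurable _ 'rV[R]_n) `<=` [set B | measurable (f @^-1` B)] by exact.
apply: smallest_sub => [|B].
  split => [|B /= mB|F /= mF].
  - by rewrite /= preimage_set0.
  - by rewrite setTD preimage_setC; exact: measurableC.
  - by rewrite preimage_bigcup; exact: bigcupT_measurable.
rewrite -bigcup_seq/= => -[i _ [Y mY <-]]; rewrite setTI.
by have := mf i measurableT Y mY; rewrite setTI.
Qed.

End row_measurable.

(* Lebesgue measure on R^n, by recursion on n: a Dirac mass on the one-point
   space R^0, and the image of the product of Lebesgue measure on R and of
   Lebesgue measure on R^n under R * R^n ~ R^(1 + n). *)
Section lebesgue_row_step.
Variables (R : realType) (n : nat).

Definition row_cons (p : measurableTypeR R * 'rV[R]_n) : 'rV[R]_n.+1 :=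
  row_mx (\row_(j < 1) (p.1 : R)) p.2.

Definition row_uncons (v : 'rV[R]_n.+1) : measurableTypeR R * 'rV[R]_n :=
  (v ord0 ord0, @rsubmx _ 1 1 n v).

Lemma row_cons0 p : row_cons p ord0 ord0 = p.1.
Proof.
have e : (ord0 : 'I_(1 + n)) = lshift n (ord0 : 'I_1) by exact/val_inj.
by rewrite [X in row_cons _ _ X]e [LHS]row_mxEl mxE.
Qed.

Lemma row_cons_lift p (i : 'I_n) : row_cons p ord0 (lift ord0 i) = p.2 ord0 i.
Proof.
have e : (lift ord0 i : 'I_(1 + n)) = rshift 1 i by exact/val_inj.
by rewrite [X in row_cons _ _ X]e [LHS]row_mxEr.
Qed.

Lemma row_consK : cancel row_cons row_uncons.
Proof.
move=> [x v]; congr pair; last exact: row_mxKr.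
by rewrite /row_cons mxE/=; case: splitP => [j _|//]; rewrite mxE.
Qed.

Lemma measurable_row_cons : measurable_fun setT row_cons.
Proof.
apply: measurable_fun_row => i; case: (unliftP ord0 i) => [k|] ->.
  apply: (eq_measurable_fun (@row_coord R n k \o snd)).
    by move=> p _; rewrite row_cons_lift.
  apply: measurableT_comp; last exact: measurable_snd.
  exact: measurable_row_coord.
apply: (eq_measurable_fun fst); last exact: measurable_fst.
by move=> p _; rewrite row_cons0.
Qed.

Lemma measurable_row_uncons : measurable_fun setT row_uncons.
Proof.
apply: measurable_fun_pair.
  exact: (@measurable_row_coord R n.+1 ord0).
apply: measurable_fun_row => i.
apply: (eq_measurable_fun (@row_coord R n.+1 (rshift 1 i))).
  by move=> v _; rewrite mxE.
exact: measurable_row_coord.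
Qed.

HB.instance Definition _ := isMeasurableFun.Build _ _ _ _ row_cons
  measurable_row_cons.

Variable mu : {sigma_finite_measure set 'rV[R]_n -> \bar R}.

Definition lebesgue_row_succ : set 'rV[R]_n.+1 -> \bar R :=
  pushforward (@lebesgue_measure R \x mu)%E row_cons.

Let succ0 : lebesgue_row_succ set0 = 0%E.
Proof. exact: measure0. Qed.

Let succ_ge0 A : (0 <= lebesgue_row_succ A)%E.
Proof. exact: measure_ge0. Qed.

Let succ_sigma_additive : semi_sigma_additive lebesgue_row_succ.
Proof. exact: measure_semi_sigma_additive. Qed.

HB.instance Definition _ := isMeasure.Build _ _ _ lebesgue_row_succ
  succ0 succ_ge0 succ_sigma_additive.

Let succ_sigma_finite : sigma_finite setT lebesgue_row_succ.
Proof.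
have /sigma_finiteP[F [TF ndF Foo]] := sigma_finiteT (@lebesgue_measure R).
have /sigma_finiteP[G [TG ndG Goo]] := sigma_finiteT mu.
exists (fun k => row_uncons @^-1` (F k `*` G k)).
  apply/seteqP; split => // v _.
  have : (\bigcup_k F k) (v ord0 ord0) by rewrite -TF.
  have : (\bigcup_k G k) (@rsubmx _ 1 1 n v) by rewrite -TG.
  move=> [l _ Gl] [k _ Fk]; exists (maxn k l) => //; split => /=.
    by move: Fk; exact/subsetPset/ndF/leq_maxl.
  by move: Gl; exact/subsetPset/ndG/leq_maxr.
move=> k; have [mF Fk] := Foo k; have [mG Gk] := Goo k; split.
  rewrite -[X in measurable X]setTI; apply: measurable_row_uncons => //.
  exact: measurableX.
rewrite /lebesgue_row_succ /pushforward -comp_preimage.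
rewrite (_ : row_uncons \o row_cons = id); last exact/funext/row_consK.
by rewrite preimage_id product_measure1E// lte_mul_pinfty// ge0_fin_numE.
Qed.

HB.instance Definition _ := Measure_isSigmaFinite.Build _ _ _ lebesgue_row_succ
  succ_sigma_finite.

End lebesgue_row_step.

Fixpoint lebesgue_row (R : realType) (n : nat) :
    {sigma_finite_measure set 'rV[R]_n -> \bar R} :=
  match n with
  | 0 => dirac (0 : 'rV[R]_0)
  | n'.+1 => lebesgue_row_succ (lebesgue_row R n')
  end.

Lemma lebesgue_row_box (R : realType) (n : nat) (A : 'I_n -> set R) :
  (forall i, measurable (A i)) ->
  lebesgue_row R n [set v | forall i, A i (v ord0 i)] =
  (\prod_(i < n) lebesgue_measure (A i))%E.
Proof.
elim: n A => [|n IH] A mA.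
  by rewrite big_ord0 /= diracE mem_set// => -[].
rewrite big_ord_recl -IH => [|i]; last exact: mA.
rewrite /= /lebesgue_row_succ /pushforward.
have -> : @row_cons R n @^-1` [set v | forall i, A i (v ord0 i)] = A ord0 `*`
    [set v : 'rV[R]_n | forall i, A (lift ord0 i) (v ord0 i)].
  apply/seteqP; split => -[x v] /=.
    move=> xvA; split => /= [|i]; first by have := xvA ord0; rewrite row_cons0.
    by have := xvA (lift ord0 i); rewrite row_cons_lift.
  move=> -[/= xA vA] i; case: (unliftP ord0 i) => [j|] ->.
    by rewrite row_cons_lift; exact: vA.
  by rewrite row_cons0.
apply: product_measure1E; first exact: mA.
rewrite [X in measurable X](_ : _ = \bigcap_(i in [set: 'I_n])
    (@row_coord R n i @^-1` A (lift ord0 i))).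
  apply: fin_bigcap_measurable => // i _.
  by rewrite -[X in measurable X]setTI; exact: measurable_row_coord.
by apply/seteqP; split => v /= vA i; [move=> _|]; exact: vA.
Qed.

Section euclidean.
Variables (R : realType) (n : nat).
Implicit Types (u v x y nu : 'rV[R]_n) (O : set 'rV[R]_n) (f : 'rV[R]_n -> R).

Definition dotrow u v : R := \sum_(i < n) u ord0 i * v ord0 i.

(* The norm `|v| of the library is the sup norm: it gives the topology of R^n,
   but lengths have to be measured with enorm. *)
Definition enorm v : R := Num.sqrt (dotrow v v).

Definition unit_ball : set 'rV[R]_n := [set v | enorm v < 1].

Definition basis_row (i : 'I_n) : 'rV[R]_n := delta_mx ord0 i.

Definition partial (i : 'I_n) f : 'rV[R]_n -> R :=
  fun x => 'D_(basis_row i) f x.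

Definition gradient f : 'rV[R]_n -> 'rV[R]_n := fun x => \row_i partial i f x.

Definition laplacian f : 'rV[R]_n -> R :=
  fun x => \sum_(i < n) partial i (partial i f) x.

Fixpoint Ck_on (k : nat) O f : Prop :=
  (forall x, O x -> {for x, continuous f}) /\
  match k with
  | 0 => True
  | k'.+1 => forall i : 'I_n,
      (forall x, O x -> derivable f x (basis_row i)) /\ Ck_on k' O (partial i f)
  end.

Definition C1_closure O f : Prop :=
  [/\ Ck_on 1 O f, {within closure O, continuous f} &
    exists2 G : 'rV[R]_n -> 'rV[R]_n,
      {within closure O, continuous G} & forall x, O x -> G x = gradient f x].

(* The values on closure O of the gradient of f, for f as in C1_closure O f; a
   derivative at a boundary point would depend on f outside closure O. *)
Definition gradient_closure O f : 'rV[R]_n -> 'rV[R]_n :=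
  fun x => lim (gradient f y @[y --> within O (nbhs x)]).

Definition boundary O : set 'rV[R]_n := closure O `\` O°.

Definition bounded_domain O : Prop := [/\ open O, connected O & bounded_set O].

(* nu is orthogonal to the boundary at x, has length 1, and points from O to
   the complement of O. *)
Definition outward_unit_normal_at O x nu : Prop :=
  [/\ enorm nu = 1,
    forall e : R, 0 < e ->
      \forall y \near x, boundary O y ->
        `|dotrow (y - x) nu| <= e * enorm (y - x),
    \forall t \near (0 : R)^'+, O (x - t *: nu) &
    \forall t \near (0 : R)^'+, ~ O (x + t *: nu)].

Definition outward_unit_normal O (nu : 'rV[R]_n -> 'rV[R]_n) : Prop :=
  forall x, boundary O x -> outward_unit_normal_at O x (nu x).

Definition dirichlet_eigenfunction O (lambda : R) f : Prop :=
  [/\ forall x, O x -> - laplacian f x = lambda * f x,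
    forall x, boundary O x -> f x = 0 &
    exists2 x, O x & f x != 0].

Lemma gradient_closureE O f (G : 'rV[R]_n -> 'rV[R]_n) x :
  {within closure O, continuous G} ->
  (forall y, O y -> G y = gradient f y) -> closure O x ->
  gradient_closure O f x = G x.
Proof.
move=> cG Gf cOx; apply: cvg_lim; first exact: norm_hausdorff.
move=> P GP; have : nbhs_subspace (A := closure O) x [set y | P (G y)].
  exact: (cG x P GP).
rewrite -nbhs_subspace_in//; move: (x) => z.
rewrite /within/= /nbhs/= /fmap/=; apply: filterS => y PG Oy.
by rewrite -Gf//; exact: (PG (subset_closure Oy)).
Qed.

End euclidean.

(* Main.v *)
Require Import Defs.
From HB Require Import structures.
From mathcomp Require Import all_boot all_order all_algebra.
From mathcomp Require Import all_classical all_reals all_analysis.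
From mathcomp Require Import measurable_realfun.
From mathcomp Require Import ring lra.

Set Implicit Arguments.
Unset Strict Implicit.
Unset Printing Implicit Defensive.

Import Order.TTheory GRing.Theory Num.Theory.
Import numFieldNormedType.Exports.

Local Open Scope classical_set_scope.
Local Open Scope ring_scope.

(* Alexandrov-Bakelman-Pucci argument. Let m be the infimum of |grad phi| on the
   boundary and |p| < m. If phi - p.x and - phi - p.x both attain their minimum
   over the closure at boundary points only, then, phi vanishing there, these
   are minima of - p.x on the boundary with the same value - p.x1, so that
   |phi y| <= p.(x1 - y) in Omega; hence |grad phi (x1)| <= |p| < m, a
   contradiction. So p is the gradient of phi or of - phi at an interior
   minimum, where the Hessian H is positive semidefinite. The two families of
   points must be used together because phi may have different signs near
   different parts of the boundary. Finally det H <= (tr H / n)^n bounds the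
   measure of the two gradient images by the integral of (lambda |phi| / n)^n,
   the integrands being supported where lambda phi <= 0 and lambda phi >= 0
   respectively. *)

(** * Borel sets and the sup norm on R^n *)

(** Each image of a contact set is enclosed in a measurable set of controlled measure. The enclosure
    is local: near a contact point the gradient map is close to the linear map given by the Hessian,
    so a cube of small side h goes into a set of measure at most (prod H_ii + eta) h^n. The cubes of
    a grid are disjoint, and their bounds add up to an integral. How small h must be depends on the
    point, without uniformity; a lower limit over h = 1/(k+1) absorbs this. Since the product of the
    diagonal already obeys the AM-GM bound by (tr H / n)^n, determinants never appear. The term eta
    pays for the linearization and for the oscillation of the integrand on a cube; it disappears at
    the end because Omega has finite measure. The estimate involves |lambda| only; that lambda is
    nonnegative comes from the same minimum argument with p = 0. *)

Section row_norm.
Variables (R : realType) (n : nat).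
Implicit Types v : 'rV[R]_n.

Lemma row_norm_leP v (e : R) : 0 <= e ->
  (`|v| <= e) <-> (forall i, `|v ord0 i| <= e).
Proof.
move=> e0; rewrite (_ : `|v| = mx_norm v)// mx_normrE; split.
  by move=> /bigmax_leP[_ ve] i; exact: (ve (ord0, i)).
by move=> ve; apply/bigmax_leP; split=> // -[i j] _ /=; rewrite (ord1 i).
Qed.

Lemma row_norm_ltP v (e : R) : 0 < e ->
  (`|v| < e) <-> (forall i, `|v ord0 i| < e).
Proof.
move=> e0; rewrite (_ : `|v| = mx_norm v)// mx_normrE; split.
  by move=> /bigmax_ltP[_ ve] i; exact: (ve (ord0, i)).
by move=> ve; apply/bigmax_ltP; split=> // -[i j] _ /=; rewrite (ord1 i).
Qed.

Lemma row_norm_coord v i : `|v ord0 i| <= `|v|.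
Proof. exact: (row_norm_leP v (normr_ge0 v)).1 (lexx _) i. Qed.

Lemma measurable_row_set (A : 'I_n -> set R) : (forall i, measurable (A i)) ->
  measurable [set v : 'rV[R]_n | forall i, A i (v ord0 i)].
Proof.
move=> mA; rewrite [X in measurable X](_ : _ = \bigcap_(i in [set: 'I_n])
    (@row_coord R n i @^-1` A i)).
  apply: fin_bigcap_measurable => // i _.
  by rewrite -[X in measurable X]setTI; exact: measurable_row_coord.
by apply/seteqP; split => v /= vA i; [move=> _|]; exact: vA.
Qed.

Lemma measurable_row_ball v (r : R) : 0 < r ->
  measurable [set w : 'rV[R]_n | `|w - v| < r].
Proof.
move=> r0; rewrite [X in measurable X](_ : _ =
    [set w : 'rV[R]_n | forall i, `]v ord0 i - r, v ord0 i + r[%classic (w ord0 i)]).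
  by apply: (@measurable_row_set (fun i => `]v ord0 i - r, v ord0 i + r[%classic)).
apply/seteqP; split => w /=.
  move=> /(row_norm_ltP _ r0) wr i; have := wr i.
  by rewrite !mxE in_itv/= ltr_distl.
move=> wr; apply/(row_norm_ltP _ r0) => i; have := wr i.
by rewrite !mxE in_itv/= ltr_distl.
Qed.

(** Sup-norm balls are boxes, hence measurable for the coordinate sigma-algebra. An open set is the
    union of the countably many balls with rational centre and radius 1/(k+1) that it contains. *)
Lemma open_measurable_row (O : set 'rV[R]_n) : open O -> measurable O.
Proof.
move=> oO.
pose B (p : {ffun 'I_n -> rat} * nat) : set 'rV[R]_n :=
  let c : 'rV[R]_n := \row_i ratr (p.1 i) in
  if `[< [set w : 'rV[R]_n | `|w - c| < p.2.+1%:R^-1] `<=` O >]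
  then [set w : 'rV[R]_n | `|w - c| < p.2.+1%:R^-1] else set0.
rewrite (_ : O = \bigcup_p B p).
  apply: countable_bigcupT_measurable => // p; rewrite /B.
  by case: ifP => // _; apply: measurable_row_ball; rewrite invr_gt0.
apply/seteqP; split => [v Ov|v [p _]]; last first.
  by rewrite /B; case: ifP => // /asboolP; exact.
have /nbhs_ballP[e /= e0 ve] : nbhs v O by apply: open_nbhs_nbhs.
have [k ke] : exists k, k.+1%:R^-1 < e / 2.
  have [k _ /(_ k (leqnn k))/=] : \forall k \near \oo, k.+1%:R^-1 < e / 2.
    by apply: near_infty_natSinv_lt (PosNum _); rewrite divr_gt0.
  by exists k.
have k0 : 0 < k.+1%:R^-1 :> R by rewrite invr_gt0.
have qP i : exists q : rat, `|ratr q - v ord0 i| < k.+1%:R^-1.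
  have [|q] := @rat_in_itvoo R (v ord0 i - k.+1%:R^-1) (v ord0 i + k.+1%:R^-1).
    by rewrite (lt_trans (y := v ord0 i))// ?ltrDl// gtrDl oppr_lt0.
  by rewrite in_itv/= => qv; exists q; rewrite ltr_distl.
have [q qv] := choice qP.
pose c : 'rV[R]_n := \row_i ratr (q i).
have cv : `|v - c| < k.+1%:R^-1.
  by apply/row_norm_ltP => // i; rewrite !mxE distrC.
exists ([ffun i => q i], k) => //; rewrite /B/=.
have -> : \row_i ratr ([ffun i0 => q i0] i) = c.
  by apply/rowP => i; rewrite !mxE ffunE.
rewrite asboolT//= => w wc; apply: ve; rewrite -ball_normE/=.
rewrite -(subrKC c w) opprD addrA (le_lt_trans (ler_normB _ _))//.
by rewrite (splitr e) ltrD// (lt_trans _ ke).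
Qed.

Lemma closed_measurable_row (C : set 'rV[R]_n) : closed C -> measurable C.
Proof.
move=> cC; rewrite -(setCK C); apply: measurableC; apply: open_measurable_row.
exact: closed_openC.
Qed.

End row_norm.

(** * Affine changes of variable on the line *)

Section affine.
Variable R : realType.

Definition affineR (c a : R) : measurableTypeR R -> measurableTypeR R :=
  fun x => c * x + a.

Lemma measurable_affineR c a : measurable_fun setT (affineR c a).
Proof. by apply: measurable_funD => //; exact: measurable_funM. Qed.

(** Both sides are measures in [A] that agree on half-open intervals, so uniqueness of Lebesgue
    measure applies. *)
Lemma lebesgue_measure_affine (c a : R) (A : set R) : 0 < c -> measurable A ->
  (lebesgue_measure A = c%:E * lebesgue_measure [set x : R | A (c * x + a)%R])%E.
Proof.
move=> c0 mA; pose c' : {nonneg R} := NngNum (ltW c0).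
have [m mE] : exists m : {measure set (measurableTypeR R) -> \bar R},
    forall B, m B = (c%:E * lebesgue_measure (affineR c a @^-1` B))%E.
  unshelve eexists (mscale c' (pushforward lebesgue_measure (affineR c a))) => //.
  exact: measurable_affineR.
rewrite -[RHS]mE; apply: (@lebesgue_measure_unique R m) => // _ [[p q] _ <-].
rewrite mE.
rewrite [X in (_ * lebesgue_measure X)%E](_ : _ = `](p - a) / c, (q - a) / c]%classic).
  rewrite !lebesgue_measure_itv/= !lte_fin ltr_pM2r ?invr_gt0// ltrD2r.
  case: ifP => _; last by rewrite mule0.
  by rewrite -!EFinB -EFinM; congr EFin; field; rewrite gt_eqF.
by apply/seteqP; split => x /=; rewrite /affineR !in_itv/= ltr_pdivrMr// ler_pdivlMr//
  ltrBlDr lerBrDr mulrC.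
Qed.

End affine.

(** * Slices of Lebesgue measure along the first coordinate and along the tail *)

Section sections.
Variables (R : realType) (n : nat).
Notation mu := (lebesgue_row R).
Implicit Types S : set 'rV[R]_n.+1.

Lemma row_unconsK : cancel (@row_uncons R n) (@row_cons R n).
Proof.
move=> v; apply/rowP => i; case: (unliftP ord0 i) => [j|] ->.
  rewrite row_cons_lift /row_uncons/= mxE.
  by congr (v _ _); exact/val_inj.
by rewrite row_cons0.
Qed.

Lemma measurable_preimage_row d1 d2 (T1 : measurableType d1)
    (T2 : measurableType d2) (f : T1 -> T2) (A : set T2) :
  measurable_fun setT f -> measurable A -> measurable (f @^-1` A).
Proof. by move=> mf mA; rewrite -[X in measurable X]setTI; exact: mf. Qed.

Lemma measurable_section1 S (x : R) : measurable S ->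
  measurable [set v | S (row_cons (x, v))].
Proof.
move=> mS; have mS' : measurable (@row_cons R n @^-1` S).
  exact: measurable_preimage_row (@measurable_row_cons R n) mS.
have := measurable_xsection (x : measurableTypeR R) mS'.
by congr measurable; apply/seteqP; split => v /=; rewrite /xsection/= inE.
Qed.

Lemma measurable_section2 S (v : 'rV[R]_n) : measurable S ->
  measurable [set x : R | S (row_cons (x, v))].
Proof.
move=> mS; have mS' : measurable (@row_cons R n @^-1` S).
  exact: measurable_preimage_row (@measurable_row_cons R n) mS.
have := measurable_ysection v mS'.
by congr measurable; apply/seteqP; split => x /=; rewrite /ysection/= inE.
Qed.

Lemma lebesgue_row_section1 S : measurable S ->
  mu n.+1 S = (\int[@lebesgue_measure R]_x mu n [set v | S (row_cons (x, v))])%E.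
Proof.
move=> mS; rewrite /= /lebesgue_row_succ /pushforward /product_measure1.
apply: eq_integral => x _ /=; congr (mu n _).
by apply/seteqP; split => v /=; rewrite /xsection/= inE.
Qed.

(** Integrating the other way round also gives the product formula on rectangles, and the product
    measure is unique. *)
Lemma lebesgue_row_section2 S : measurable S ->
  mu n.+1 S = (\int[mu n]_v @lebesgue_measure R [set x | S (row_cons (x, v))])%E.
Proof.
move=> mS; rewrite /= /lebesgue_row_succ /pushforward.
rewrite (@product_measure_unique _ _ _ _ _ (@lebesgue_measure R) (mu n)
  (@lebesgue_measure R \x^ mu n)%E)/=; first last.
- exact: measurable_preimage_row (@measurable_row_cons R n) mS.
- by move=> A B mA mB; exact: product_measure2E.
rewrite /product_measure2; apply: eq_integral => v _ /=.
congr (lebesgue_measure _).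
by apply/seteqP; split => x /=; rewrite /ysection/= inE.
Qed.

Lemma measurable_fun_section1 S : measurable S ->
  measurable_fun [set: measurableTypeR R]
    (fun x => mu n [set v | S (row_cons (x, v))]).
Proof.
move=> mS; have mS' : measurable (@row_cons R n @^-1` S).
  exact: measurable_preimage_row (@measurable_row_cons R n) mS.
apply: (eq_measurable_fun (mu n \o xsection (@row_cons R n @^-1` S))).
  move=> x _ /=; congr (mu n _).
  by apply/seteqP; split => v /=; rewrite /xsection/= inE.
exact: measurable_fun_xsection.
Qed.

Lemma measurable_fun_section2 S : measurable S ->
  measurable_fun [set: 'rV[R]_n]
    (fun v => @lebesgue_measure R [set x | S (row_cons (x, v))]).
Proof.
move=> mS; have mS' : measurable (@row_cons R n @^-1` S).
  exact: measurable_preimage_row (@measurable_row_cons R n) mS.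
apply: (eq_measurable_fun (@lebesgue_measure R \o ysection (@row_cons R n @^-1` S))).
  move=> v _ /=; congr (lebesgue_measure _).
  by apply/seteqP; split => x /=; rewrite /ysection/= inE.
exact: measurable_fun_ysection.
Qed.

End sections.

(** * Images of sets under linear maps *)

Section linear_images.
Variable R : realType.
Notation mu := (lebesgue_row R).

Lemma measurable_row_affine (m n : nat) (M : 'M[R]_(m, n)) (a : 'rV[R]_n) :
  measurable_fun setT (fun v : 'rV[R]_m => v *m M + a).
Proof.
apply: measurable_fun_row => i.
apply: (eq_measurable_fun (fun v : 'rV[R]_m => \sum_j v ord0 j * M j i + a ord0 i)).
  by move=> v _; rewrite !mxE.
apply: measurable_funD => //; apply: measurable_sum => j.
by apply: measurable_funM => //; exact: measurable_row_coord.
Qed.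

Lemma measurable_preimage_affine (m n : nat) (M : 'M[R]_(m, n)) (a : 'rV[R]_n)
    (S : set 'rV[R]_n) : measurable S ->
  measurable [set v : 'rV[R]_m | S (v *m M + a)].
Proof.
by move=> mS; apply: measurable_preimage_row (measurable_row_affine M a) mS.
Qed.

Lemma row_consD n (p q : measurableTypeR R * 'rV[R]_n) :
  row_cons p + row_cons q = row_cons (((p.1 : R) + q.1 : R), p.2 + q.2).
Proof.
apply/rowP => i; rewrite mxE; case: (unliftP ord0 i) => [j|] ->.
  by rewrite !row_cons_lift mxE.
by rewrite !row_cons0.
Qed.

(** Slices at fixed first coordinate reduce the tail of [a] to the induction hypothesis; slices at
    fixed tail reduce its first coordinate to a translation of the line. *)
Lemma lebesgue_row_translate n (a : 'rV[R]_n) (S : set 'rV[R]_n) :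
  measurable S -> mu n [set v | S (v + a)] = mu n S.
Proof.
elim: n a S => [|n IH] a S mS.
  by congr (mu 0 _); apply/seteqP; split=> v; rewrite /= (thinmx0 (v + a)) (thinmx0 v).
have mSa (b : 'rV[R]_n.+1) : measurable [set v | S (v + b)].
  have := measurable_preimage_affine 1%:M b mS.
  by congr measurable; apply/seteqP; split => v /=; rewrite mulmx1.
pose b := (row_uncons a).2; pose c : R := a ord0 ord0.
have aE : a = row_cons (c : measurableTypeR R, b) by rewrite -[LHS]row_unconsK.
transitivity (mu n.+1 [set v | S (v + row_cons (c : measurableTypeR R, 0))]).
  rewrite !lebesgue_row_section1//; apply: eq_integral => x _.
  rewrite -[RHS](IH b); last exact: measurable_section1.
  by congr (mu n _); apply/seteqP; split => v /=; rewrite aE !row_consD/= addr0.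
rewrite !lebesgue_row_section2//; apply: eq_integral => v _.
rewrite [RHS](@lebesgue_measure_affine _ 1 c)//; last exact: measurable_section2.
rewrite mul1e; congr (lebesgue_measure _).
by apply/seteqP; split => x /=; rewrite row_consD/= mul1r addr0.
Qed.

(** For a symmetric H with corner a > 0, first row (a, b) and remaining block D, put y = x + a^-1 (v
    . b). Then (x, v) H = (a y, y b + v (D - a^-1 b^T b)). So H is the substitution x -> y, then the
    Schur complement on each slice of fixed y, then [row_scale_shear a b]. [row_shear] with c = -
    a^-1 b^T inverts the substitution. *)
Definition row_shear n (c : 'cV[R]_n) (w : 'rV[R]_n.+1) : 'rV[R]_n.+1 :=
  row_cons ((w ord0 ord0 + ((row_uncons w).2 *m c) ord0 ord0 : R)
            : measurableTypeR R, (row_uncons w).2).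

Definition row_scale_shear n (a : R) (b : 'rV[R]_n) (w : 'rV[R]_n.+1) :
    'rV[R]_n.+1 :=
  row_cons ((a * w ord0 ord0 : R) : measurableTypeR R,
            (row_uncons w).2 + w ord0 ord0 *: b).

Lemma measurable_row_uncons1 n :
  measurable_fun setT (fun w : 'rV[R]_n.+1 => w ord0 ord0).
Proof. exact: (@measurable_row_coord R n.+1 ord0). Qed.

Lemma measurable_row_uncons2 n :
  measurable_fun setT (fun w : 'rV[R]_n.+1 => (row_uncons w).2).
Proof. by apply: measurableT_comp => //; exact: measurable_row_uncons. Qed.

Lemma measurable_row_shear n (c : 'cV[R]_n) :
  measurable_fun setT (row_shear c).
Proof.
apply: measurableT_comp; first exact: measurable_row_cons.
apply: measurable_fun_pair; last exact: measurable_row_uncons2.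
apply: measurable_funD; first exact: measurable_row_uncons1.
apply: (@measurableT_comp _ _ _ _ _ _ (fun v : 'rV[R]_n => (v *m c) ord0 ord0));
  last exact: measurable_row_uncons2.
apply: (@measurableT_comp _ _ _ _ _ _ (@row_coord R 1 ord0)).
  exact: measurable_row_coord.
have := measurable_row_affine c 0; apply: eq_measurable_fun => v _.
by rewrite addr0.
Qed.

Lemma measurable_row_scale_shear n (a : R) (b : 'rV[R]_n) :
  measurable_fun setT (row_scale_shear a b).
Proof.
have m1 := @measurable_row_uncons1 n.
apply: measurableT_comp; first exact: measurable_row_cons.
apply: measurable_fun_pair; first exact: measurable_funM.
apply: measurable_fun_row => i.
apply: (eq_measurable_fun (fun w : 'rV[R]_n.+1 =>
    (row_uncons w).2 ord0 i + w ord0 ord0 * b ord0 i)).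
  by move=> w _; rewrite !mxE.
apply: measurable_funD; last exact: measurable_funM.
apply: (@measurableT_comp _ _ _ _ _ _ (@row_coord R n i)).
  exact: measurable_row_coord.
exact: measurable_row_uncons2.
Qed.

Lemma lebesgue_row_shear n (c : 'cV[R]_n) (S : set 'rV[R]_n.+1) :
  measurable S -> mu n.+1 (row_shear c @^-1` S) = mu n.+1 S.
Proof.
move=> mS.
have mS' := measurable_preimage_row (@measurable_row_shear n c) mS.
rewrite !lebesgue_row_section2//; apply: eq_integral => v _.
rewrite [RHS](@lebesgue_measure_affine _ 1 ((v *m c) ord0 ord0))//;
  last exact: measurable_section2.
rewrite mul1e; congr (lebesgue_measure _).
by apply/seteqP; split => x /=; rewrite /row_shear row_cons0 row_consK/= mul1r.
Qed.

(** At fixed first coordinate x the shear translates the tail by [x *: b]; what remains is a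
    dilation of the first coordinate. *)
Lemma lebesgue_row_scale_shear n (a : R) (b : 'rV[R]_n) (S : set 'rV[R]_n.+1) :
  0 < a -> measurable S ->
  mu n.+1 S = (a%:E * mu n.+1 (row_scale_shear a b @^-1` S))%E.
Proof.
move=> a0 mS; pose S1 := row_scale_shear a (0 : 'rV[R]_n) @^-1` S.
have mS1 : measurable S1.
  exact: measurable_preimage_row (@measurable_row_scale_shear n a 0) mS.
have mS' := measurable_preimage_row (@measurable_row_scale_shear n a b) mS.
transitivity (a%:E * mu n.+1 S1)%E.
  rewrite !lebesgue_row_section2// -ge0_integralZl//; last 2 first.
    exact: measurable_fun_section2.
    by rewrite lee_fin ltW.
  apply: eq_integral => v _.
  rewrite [LHS](@lebesgue_measure_affine _ a 0)//; last exact: measurable_section2.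
  congr (_ * lebesgue_measure _)%E.
  by apply/seteqP; split => x /=;
    rewrite /S1/= /row_scale_shear row_cons0 row_consK/= scaler0 !addr0.
congr (_ * _)%E; rewrite !lebesgue_row_section1//; apply: eq_integral => x _.
rewrite -[LHS](lebesgue_row_translate (x *: b)); last exact: measurable_section1.
by congr (mu n _); apply/seteqP; split => v /=;
  rewrite /S1/= /row_scale_shear !row_cons0 !row_consK/= scaler0 addr0.
Qed.

End linear_images.

(** * Positive semidefinite matrices and Schur complements *)

Section psd.
Variable R : realType.
Notation mu := (lebesgue_row R).

Definition psd n (H : 'M[R]_n) :=
  H^T = H /\ forall v : 'rV[R]_n, 0 <= dotrow (v *m H) v.

Lemma dotrow_mulmx n (u v : 'rV[R]_n) : dotrow u v = (u *m v^T) ord0 ord0.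
Proof. by rewrite mxE; apply: eq_bigr => i _; rewrite mxE. Qed.

Lemma dotrowC n (u v : 'rV[R]_n) : dotrow u v = dotrow v u.
Proof. by apply: eq_bigr => i _; rewrite mulrC. Qed.

Lemma dotrowDl n (u v w : 'rV[R]_n) : dotrow (u + v) w = dotrow u w + dotrow v w.
Proof. by rewrite !dotrow_mulmx mulmxDl mxE. Qed.

Lemma dotrowZl n a (u v : 'rV[R]_n) : dotrow (a *: u) v = a * dotrow u v.
Proof. by rewrite !dotrow_mulmx -scalemxAl mxE. Qed.

Lemma dotrowNl n (u v : 'rV[R]_n) : dotrow (- u) v = - dotrow u v.
Proof. by rewrite -scaleN1r dotrowZl mulN1r. Qed.

Lemma dotrowDr n (u v w : 'rV[R]_n) : dotrow w (u + v) = dotrow w u + dotrow w v.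
Proof. by rewrite !(dotrowC w) dotrowDl. Qed.

Lemma dotrowZr n a (u v : 'rV[R]_n) : dotrow u (a *: v) = a * dotrow u v.
Proof. by rewrite !(dotrowC u) dotrowZl. Qed.

Lemma dotrowNr n (u v : 'rV[R]_n) : dotrow v (- u) = - dotrow v u.
Proof. by rewrite !(dotrowC v) dotrowNl. Qed.

Lemma dotrow_ge0 n (u : 'rV[R]_n) : 0 <= dotrow u u.
Proof. by apply: sumr_ge0 => i _; rewrite -expr2 sqr_ge0. Qed.

Lemma dotrow_eq0 n (u : 'rV[R]_n) : dotrow u u = 0 -> u = 0.
Proof.
move=> /eqP; rewrite psumr_eq0 => [/allP u0|i _]; last by rewrite -expr2 sqr_ge0.
apply/rowP => i; rewrite mxE; apply/eqP.
by have := u0 i (mem_index_enum i); rewrite -expr2 sqrf_eq0.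
Qed.

Lemma dotrow_basisr n (u : 'rV[R]_n) i : dotrow u (basis_row R i) = u ord0 i.
Proof.
rewrite /dotrow (bigD1 i)//= big1 => [|j ji]; first by rewrite !mxE !eqxx mulr1 addr0.
by rewrite !mxE eqxx (negbTE ji) mulr0.
Qed.

Lemma psd_diag n (H : 'M[R]_n) i : psd H -> 0 <= H i i.
Proof. by move=> [_ /(_ (basis_row R i))]; rewrite dotrow_basisr -rowE mxE. Qed.

Lemma dotrow_row_cons n (p q : measurableTypeR R * 'rV[R]_n) :
  dotrow (row_cons p) (row_cons q) = (p.1 : R) * q.1 + dotrow p.2 q.2.
Proof.
rewrite /dotrow big_ord_recl !row_cons0; congr (_ + _).
by apply: eq_bigr => i _; rewrite !row_cons_lift.
Qed.

Section blocks.
Variables (n : nat) (H : 'M[R]_n.+1).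

Definition hd_row : 'rV[R]_n := \row_j H ord0 (lift ord0 j).

Definition tl_mx : 'M[R]_n := \matrix_(i, j) H (lift ord0 i) (lift ord0 j).

Definition schur : 'M[R]_n :=
  tl_mx - (H ord0 ord0)^-1 *: (hd_row^T *m hd_row).

Lemma row_cons_mulmx (x : R) (v : 'rV[R]_n) : H^T = H ->
  row_cons (x : measurableTypeR R, v) *m H =
  row_cons ((x * H ord0 ord0 + dotrow v hd_row : R) : measurableTypeR R,
            x *: hd_row + v *m tl_mx).
Proof.
move=> symH; have HC i j : H i j = H j i by rewrite -{1}symH mxE.
apply/rowP => k; rewrite mxE big_ord_recl row_cons0.
under eq_bigr do rewrite row_cons_lift.
case: (unliftP ord0 k) => [j|] ->; last first.
  rewrite row_cons0/=; congr (_ + _); apply: eq_bigr => i _.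
  by rewrite mxE HC.
rewrite row_cons_lift !mxE/=; congr (_ + _); apply: eq_bigr => i _.
by rewrite mxE.
Qed.

Lemma dotrow_row_cons_mulmx (x : R) (v : 'rV[R]_n) : H^T = H ->
  let w := row_cons (x : measurableTypeR R, v) in
  dotrow (w *m H) w = H ord0 ord0 * x ^+ 2 + 2 * x * dotrow v hd_row
                      + dotrow (v *m tl_mx) v.
Proof.
move=> symH; rewrite /= row_cons_mulmx// dotrow_row_cons/= dotrowDl dotrowZl.
by rewrite (dotrowC hd_row); ring.
Qed.

Lemma tl_mx_sym : H^T = H -> tl_mx^T = tl_mx.
Proof. by move=> symH; apply/matrixP => i j; rewrite !mxE -{1}symH mxE. Qed.

Lemma hd_row_eq0 : psd H -> H ord0 ord0 = 0 -> hd_row = 0.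
Proof.
move=> [symH H0] H00; apply: dotrow_eq0; apply/eqP/negPn/negP => b0.
set q := dotrow (hd_row *m tl_mx) hd_row.
(* With a zero corner the form at (x, b), b = [hd_row], is 2 x |b|^2 + q, affine in x; this x makes
   it -1. *)
have := H0 (row_cons ((- (q + 1) / (2 * dotrow hd_row hd_row) : R)
                      : measurableTypeR R, hd_row)).
rewrite dotrow_row_cons_mulmx// H00 mul0r add0r -/q.
have -> : 2 * (- (q + 1) / (2 * dotrow hd_row hd_row)) * dotrow hd_row hd_row + q = -1.
  by field.
by rewrite lerNr oppr0 ler10.
Qed.

Lemma mulmx_schur v : v *m schur =
  v *m tl_mx - ((H ord0 ord0)^-1 * dotrow v hd_row) *: hd_row.
Proof.
rewrite /schur mulmxBr -scalemxAr mulmxA; congr (_ - _).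
rewrite [v *m hd_row^T]mx11_scalar -dotrow_mulmx mul_scalar_mx.
by rewrite scalerA.
Qed.

(** The form of [schur] at v is the form of [H] at (x, v) for x = - a^-1 (v . b), with a the corner
    and b the rest of the first row. *)
Lemma psd_schur : psd H -> 0 < H ord0 ord0 -> psd schur.
Proof.
move=> [symH H0] a0; split.
  by rewrite /schur raddfB/= linearZ/= trmx_mul trmxK tl_mx_sym.
move=> v; rewrite mulmx_schur dotrowDl dotrowNl dotrowZl.
have := H0 (row_cons ((- (H ord0 ord0)^-1 * dotrow v hd_row : R) : measurableTypeR R, v)).
rewrite dotrow_row_cons_mulmx// (dotrowC hd_row v).
by congr (_ <= _); field; rewrite gt_eqF.
Qed.

Lemma schur_diag_le i : 0 < H ord0 ord0 -> schur i i <= H (lift ord0 i) (lift ord0 i).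
Proof.
move=> a0; rewrite /schur !mxE gerBl mulr_ge0 ?invr_ge0 ?(ltW a0)//.
by apply: sumr_ge0 => k _; rewrite !mxE -expr2 sqr_ge0.
Qed.

End blocks.

(* Hadamard's inequality and the change of variables in one induction: the
   Schur complement splits H into two shears, a dilation of the first
   coordinate and an (n-1)-dimensional map, so no determinant is needed. *)
Lemma lebesgue_row_psd_image n (H : 'M[R]_n) (S T : set 'rV[R]_n) : psd H ->
  measurable S -> measurable T -> T `<=` [set v *m H | v in S] ->
  (mu n T <= (\prod_i H i i)%:E * mu n S)%E.
Proof.
elim: n H S T => [|n IH] H S T psdH mS mT TS.
  rewrite big_ord0 mul1e le_measure ?inE// => t /TS[s Ss _].
  by rewrite (thinmx0 t) -(thinmx0 s).
have [symH _] := psdH; have a0 := psd_diag ord0 psdH.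
rewrite big_ord_recl; move: a0; rewrite le_eqVlt => /predU1P[/esym a0|a0].
  (* A zero corner forces the first row and column to vanish, so [T] lies in the hyperplane of first
     coordinate 0 and is null. *)
  rewrite a0 mul0r mul0e lebesgue_row_section2// integral0_eq// => v _.
  apply/eqP; rewrite eq_le measure_ge0 andbT -(lebesgue_measure_set1 (0 : R)).
  rewrite le_measure ?inE//; first exact: measurable_section2.
  move=> x /= /TS[s _ sx]; rewrite -(row_unconsK s) row_cons_mulmx// in sx.
  rewrite (hd_row_eq0 psdH a0) a0 mulr0 add0r in sx.
  have := congr1 (fun u : 'rV[R]_n.+1 => u ord0 ord0) sx.
  rewrite !row_cons0/= => <-; rewrite /dotrow big1// => i _.
  by rewrite [X in _ * X]mxE mulr0.
pose a := H ord0 ord0; pose b := hd_row H.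
pose S1 := row_shear (- a^-1 *: b^T) @^-1` S.
pose T1 := row_scale_shear a b @^-1` T.
have mS1 : measurable S1.
  exact: measurable_preimage_row (@measurable_row_shear _ _ _) mS.
have mT1 : measurable T1.
  exact: measurable_preimage_row (@measurable_row_scale_shear _ _ _ _) mT.
have Sch0 i : 0 <= schur H i i by exact/psd_diag/psd_schur.
have T1S1 : (mu n.+1 T1 <= (\prod_i schur H i i)%:E * mu n.+1 S1)%E.
  rewrite !lebesgue_row_section1// -ge0_integralZl//; last 2 first.
    exact: measurable_fun_section1.
    by rewrite lee_fin prodr_ge0.
  apply: ge0_le_integral => //.
  - exact: measurable_fun_section1.
  - by apply: measurable_funeM; exact: measurable_fun_section1.
  (* In the new coordinates the slice of [T1] at y comes from the slice of [S1] at the same y by the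
     Schur complement alone. *)
  move=> y _; apply: IH; [exact: psd_schur|exact: measurable_section1..|].
  move=> u /= /TS[s Ss].
  rewrite /row_scale_shear row_cons0 row_consK/=.
  rewrite -{1}(row_unconsK s) row_cons_mulmx// => /(congr1 (@row_uncons R n)).
  rewrite !row_consK => -[]/= ay bu.
  set x := s ord0 ord0 in ay bu; set v := (row_uncons s).2 in ay bu.
  have yE : y = x + a^-1 * dotrow v b.
    by apply: (mulfI (lt0r_neq0 a0)); rewrite -ay /a /b; field; rewrite gt_eqF.
  exists v.
    rewrite /S1/= /row_shear row_cons0 row_consK/= -scalemxAr mxE -dotrow_mulmx.
    by rewrite yE mulNr addrK -[X in S X](_ : s = _)//; rewrite -[LHS]row_unconsK.
  rewrite mulmx_schur -/b -/a -[RHS](addrK (y *: b)) -bu yE.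
  by rewrite scalerDl; rewrite [x *: b + _]addrC opprD addrA addrK.
rewrite (@lebesgue_row_scale_shear _ _ a b)//.
rewrite -(@lebesgue_row_shear _ _ (- a^-1 *: b^T) S)//.
rewrite EFinM -muleA lee_wpmul2l// ?lee_fin ?(ltW a0)// (le_trans T1S1)//.
rewrite lee_wpmul2r// lee_fin ler_prod// => i _.
by rewrite Sch0/= schur_diag_le.
Qed.

End psd.

(** * Images of small cubes and coverings by grids *)

Section cubes.
Variables (R : realType) (n : nat).
Notation mu := (lebesgue_row R n).

Lemma row_nbhsP (x : 'rV[R]_n) (P : set 'rV[R]_n) : (\forall y \near x, P y) ->
  exists2 r, 0 < r & forall y, `|y - x| < r -> P y.
Proof.
move=> /nbhs_ballP[r /= r0 xr]; exists r => // y yx; apply: xr.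
by rewrite -ball_normE/= distrC.
Qed.

Lemma row_near (x : 'rV[R]_n) (P : set 'rV[R]_n) (r : R) : 0 < r ->
  (forall y, `|y - x| < r -> P y) -> \forall y \near x, P y.
Proof.
move=> r0 xr; apply/nbhs_ballP; exists r => // y.
by rewrite -ball_normE/= distrC => /xr.
Qed.

Lemma row_mulmx_bound (H : 'M[R]_n) :
  exists2 C, 0 < C & forall v : 'rV[R]_n, `|v *m H| <= C * `|v|.
Proof.
exists (1 + \sum_i \sum_j `|H i j|).
  by rewrite ltr_pwDl// sumr_ge0// => i _; rewrite sumr_ge0.
move=> v; apply/row_norm_leP => [|j].
  by rewrite mulr_ge0// addr_ge0// sumr_ge0// => i _; rewrite sumr_ge0.
rewrite mxE (le_trans (ler_norm_sum _ _ _))// mulrDl mul1r.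
rewrite (@le_trans _ _ ((\sum_i \sum_j `|H i j|) * `|v|))//; last by rewrite lerDr.
rewrite mulr_suml ler_sum// => i _; rewrite normrM mulrC ler_pM ?row_norm_coord//.
by rewrite (bigD1 j)//= lerDl sumr_ge0.
Qed.

Lemma continuous_row_mulmx (H : 'M[R]_n) : continuous (fun v : 'rV[R]_n => v *m H).
Proof.
have [C C0 HC] := row_mulmx_bound H.
move=> v; apply/(@cvgrPdist_lt _ _ _ _ (nbhs_filter v)) => e e0.
apply: (@row_near _ _ (e / C)); first by rewrite divr_gt0.
move=> w wv; rewrite -mulmxBl (le_lt_trans (HC _))//.
by rewrite distrC mulrC -ltr_pdivlMr.
Qed.

Lemma lebesgue_row_ball_lty (A : set 'rV[R]_n) (M : R) : measurable A ->
  (forall v, A v -> `|v| <= M) -> (mu A < +oo)%E.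
Proof.
move=> mA AM.
have mI (i : 'I_n) : measurable (`[- `|M|, `|M|]%classic : set R).
    exact: measurable_itv.
apply: (@le_lt_trans _ _ (mu [set v | forall i, `[- `|M|, `|M|]%classic (v ord0 i)])).
  rewrite le_measure ?inE//.
    exact: (measurable_row_set mI).
  move=> v /AM vM i /=; rewrite in_itv/= -ler_norml.
  by rewrite (le_trans (row_norm_coord _ _))// (le_trans vM)// ler_norm.
rewrite (lebesgue_row_box mI) (eq_bigr (fun=> (`|M| + `|M|)%:E)) => [|i _].
  by rewrite prodEFin ltry.
rewrite lebesgue_measure_itv/= lte_fin.
case: ifPn => [_|]; first by rewrite -EFinB opprK.
rewrite -leNgt => M0; congr EFin.
by have := normr_ge0 M; lra.
Qed.

(** Half-open, so that the cubes of a grid partition the space. *)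
Definition cube (c : 'rV[R]_n) (h : R) : set 'rV[R]_n :=
  [set v | forall i, `[c ord0 i, c ord0 i + h[%classic (v ord0 i)].

Lemma measurable_cube c h : measurable (cube c h).
Proof.
by apply: (@measurable_row_set R n (fun i => `[c ord0 i, c ord0 i + h[%classic)).
Qed.

Lemma lebesgue_row_cube c h : 0 < h -> mu (cube c h) = (h ^+ n)%:E.
Proof.
move=> h0; rewrite /cube (lebesgue_row_box (fun i => measurable_itv _)).
rewrite (eq_bigr (fun=> h%:E)) => [|i _].
  by rewrite prodEFin prodr_const card_ord.
by rewrite lebesgue_measure_itv/= lte_fin ltrDl h0 -EFinB addrAC subrr add0r.
Qed.

Lemma cube_dist c h v w : 0 < h -> cube c h v -> cube c h w -> `|v - w| < h.
Proof.
move=> h0 cv cw; apply/row_norm_ltP => // i; rewrite !mxE.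
have := cv i; have := cw i; rewrite /= !in_itv/= => /andP[w1 w2] /andP[v1 v2].
by rewrite ltr_norml; apply/andP; split; lra.
Qed.

(** Closed, unlike [cube], so that its linear images are compact. *)
Definition unit_cube : set 'rV[R]_n :=
  [set v | forall i, `[0, 1]%classic (v ord0 i)].

Lemma compact_unit_cube : compact unit_cube.
Proof.
by apply: (@rV_compact R n (fun=> `[0, 1]%classic)) => i; exact: segment_compact.
Qed.

Lemma lebesgue_row_unit_cube : mu unit_cube = 1%E.
Proof.
rewrite /unit_cube (lebesgue_row_box (fun i => measurable_itv _)).
by rewrite big1// => i _; rewrite lebesgue_measure_itv/= lte_fin ltr01 oppr0 adde0.
Qed.

Lemma lebesgue_row_scale (h : R) (S T : set 'rV[R]_n) : 0 <= h ->
  measurable S -> measurable T -> T `<=` [set h *: v | v in S] ->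
  (mu T <= (h ^+ n)%:E * mu S)%E.
Proof.
move=> h0 mS mT TS.
have -> : h ^+ n = \prod_i (h%:M : 'M[R]_n) i i.
  by rewrite (eq_bigr (fun=> h)) ?prodr_const ?card_ord// => i _; rewrite mxE eqxx.
apply: lebesgue_row_psd_image => //.
  split; first exact: tr_scalar_mx.
  by move=> v; rewrite mul_mx_scalar dotrowZl mulr_ge0// dotrow_ge0.
by move=> t /TS[v Sv <-]; exists v => //; rewrite mul_mx_scalar.
Qed.

Definition unit_cube_image_nbhs (H : 'M[R]_n) (r : R) : set 'rV[R]_n :=
  [set y | exists2 v, unit_cube v & `|y - v *m H| < r].

(** The linear image K of the unit cube is compact, so its neighbourhoods of radius 1/(k+1) decrease
    to K and their measures converge to that of K, which is at most the diagonal product. One of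
    them is therefore below this product plus eta. *)
Lemma psd_image_unit_cube_nbhs (H : 'M[R]_n) (eta : R) : psd H -> 0 < eta ->
  exists2 r, 0 < r &
    (mu (unit_cube_image_nbhs H r) <= (\prod_i H i i + eta)%:E)%E /\
    measurable (unit_cube_image_nbhs H r).
Proof.
move=> psdH eta0.
pose K := [set v *m H | v in unit_cube].
have cK : compact K.
  apply: continuous_compact; last exact: compact_unit_cube.
  by apply: continuous_subspaceT => v; exact: continuous_row_mulmx.
have clK : closed K by apply: compact_closed => //; exact: norm_hausdorff.
have mK : measurable K by exact: closed_measurable_row.
have mU : measurable unit_cube.
  by apply: closed_measurable_row; apply: compact_closed;
    [exact: norm_hausdorff|exact: compact_unit_cube].
pose B r := unit_cube_image_nbhs H r.
have mB r : measurable (B r).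
  apply: open_measurable_row; rewrite openE => y [v uv yv].
  have d0 : 0 < r - `|y - v *m H| by rewrite subr_gt0.
  apply: (row_near d0) => z zy; exists v => //.
  rewrite -(subrK y z) -addrA (le_lt_trans (ler_normD _ _))//.
  by rewrite -ltrBrDr.
pose F k := B k.+1%:R^-1.
have FK : \bigcap_k F k = K.
  apply/seteqP; split => [y Fy|_ [v uv <-] k _]; last first.
    by exists v => //; rewrite subrr normr0 invr_gt0.
  apply: clK => P /row_nbhsP[r r0 yr].
  have [k kr] : exists k, k.+1%:R^-1 < r.
    have [k _ /(_ k (leqnn k))/=] := near_infty_natSinv_lt (PosNum r0).
    by exists k.
  have [v uv yv] := Fy k I; exists (v *m H); split; first by exists v.
  by apply: yr; rewrite distrC (lt_trans yv).
have muK : (mu K <= (\prod_i H i i)%:E)%E.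
  have := @lebesgue_row_psd_image R n H unit_cube K psdH mU mK (@subset_refl _ _).
  by rewrite lebesgue_row_unit_cube mule1.
have [C C0 HC] := row_mulmx_bound H.
have F0 : (mu (F 0%N) < +oo)%E.
  apply: (@lebesgue_row_ball_lty _ (C + 1)); first exact: mB.
  move=> y [v uv yv].
  rewrite -(subrK (v *m H) y) addrC (le_trans (ler_normD _ _))//.
  rewrite lerD//; last by rewrite (le_trans (ltW yv))// invr1.
  rewrite (le_trans (HC v))// -[leRHS]mulr1 ler_wpM2l ?(ltW C0)//.
  apply/row_norm_leP => // i; have := uv i.
  by rewrite /= in_itv/= ler_norml => /andP[v0 ->]; rewrite (le_trans _ v0)// lerN10.
have cF : (mu \o F @ \oo --> mu K).
  rewrite -FK; apply: nonincreasing_cvg_mu => //.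
  - by move=> k; exact: mB.
  - by rewrite FK.
  move=> k l kl; apply/subsetPset => y [v uv yv]; exists v => //.
  by rewrite (lt_le_trans yv)// lef_pV2 ?posrE// ler_nat.
have [[k kP]|noP] := pselect (exists k, (mu (F k) <= (\prod_i H i i + eta)%:E)%E).
  by exists k.+1%:R^-1; rewrite ?invr_gt0.
suff : ((\prod_i H i i + eta)%:E <= mu K)%E.
  by move=> /le_trans/(_ muK); rewrite lee_fin gerDl leNgt eta0.
rewrite -(cvg_lim _ cF)//; apply: lime_ge; first exact: (cvgP _ cF).
apply: nearW => k; rewrite leNgt; apply/negP => /ltW kP.
by apply: noP; exists k.
Qed.

(** After rescaling by 1/h and a translation, the image of the cube lies within s of the linear
    image of the unit cube, where s comes from [psd_image_unit_cube_nbhs]. The same r serves every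
    small cube containing x, wherever x sits in it. *)
Lemma cube_image_bound (F : 'rV[R]_n -> 'rV[R]_n) (x : 'rV[R]_n) (H : 'M[R]_n)
    (eta : R) : psd H -> 0 < eta ->
  (forall e, 0 < e -> \forall y \near x, `|F y - F x - (y - x) *m H| <= e * `|y - x|) ->
  exists2 r, 0 < r & forall h c, 0 < h -> h < r -> cube c h x ->
    exists2 T, measurable T & [set F y | y in cube c h] `<=` T /\
      (mu T <= ((\prod_i H i i + eta) * h ^+ n)%:E)%E.
Proof.
move=> psdH eta0 dF.
have [s s0 [muB mB]] := psd_image_unit_cube_nbhs psdH eta0.
set B := unit_cube_image_nbhs H s in muB mB.
have [r r0 xr] := row_nbhsP (dF s s0).
exists r => // h c h0 hr cx.
(* With this translation, h^-1 F y + a - h^-1 (y - c) H is 1/h times the linearization error F y - F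
   x - (y - x) H. *)
pose a := - (h^-1 *: (F x - (x - c) *m H)).
pose T := [set y : 'rV[R]_n | B (y *m (h^-1)%:M + a)].
have mT : measurable T by exact: measurable_preimage_affine.
exists T => //; split.
  move=> _ [y cy <-]; rewrite /T/= mul_mx_scalar.
  exists (h^-1 *: (y - c)).
    move=> i; have := cy i; rewrite /= !in_itv/= !mxE mulrC => /andP[y1 y2].
    by rewrite divr_ge0 ?subr_ge0 ?(ltW h0)//= ler_pdivrMr// mul1r lerBlDl ltW.
  have -> : h^-1 *: F y + a - h^-1 *: (y - c) *m H =
            h^-1 *: (F y - F x - (y - x) *m H).
    rewrite /a -scalemxAl -!scalerN -!scalerDr; congr (_ *: _).
    rewrite !mulmxBl !opprB; apply/rowP => i; rewrite !mxE; ring.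
  rewrite normrZ gtr0_norm ?invr_gt0// mulrC ltr_pdivrMr//.
  rewrite (le_lt_trans (xr y _))//.
    by rewrite (lt_trans _ hr)// (cube_dist h0 cy cx).
  by rewrite ltr_pM2l// (cube_dist h0 cy cx).
(* [S] is the dilate of [B] by h: the shift cancels the constant a. *)
pose S := [set y | T (y + h *: - a)].
have mS : measurable S.
  have := measurable_preimage_affine 1%:M (h *: - a) mT.
  by congr measurable; apply/seteqP; split => v /=; rewrite mulmx1.
rewrite -(lebesgue_row_translate (h *: - a))//.
apply: (@le_trans _ _ ((h ^+ n)%:E * mu B)%E).
  apply: lebesgue_row_scale => //; first exact: ltW.
  move=> y; rewrite /S/T/= mul_mx_scalar scalerDr scalerA mulVf ?gt_eqF//.
  rewrite scale1r subrK => By; exists (h^-1 *: y) => //.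
  by rewrite scalerA mulfV ?scale1r// gt_eqF.
by rewrite mulrC EFinM lee_wpmul2l// lee_fin exprn_ge0// ltW.
Qed.

End cubes.

(** * Coverings by grids of cubes *)

Section covering.
Variables (R : realType) (n : nat).
Notation mu := (lebesgue_row R n).

Definition grid_corner (h : R) (z : {ffun 'I_n -> int}) : 'rV[R]_n :=
  \row_i ((z i)%:~R * h).

Lemma cube_gridP (h : R) z v : 0 < h ->
  cube (grid_corner h z) h v <-> z = [ffun i => Num.floor (v ord0 i / h)].
Proof.
move=> h0; split=> [vz|-> i].
  apply/ffunP => i; rewrite ffunE; apply/esym/floor_def.
  have := vz i; rewrite /= in_itv/= mxE => /andP[v1 v2].
  by rewrite ler_pdivlMr// ltr_pdivrMr// v1/= intrD mulrDl mul1r.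
rewrite /= in_itv/= mxE ffunE.
have := floor_itv (v ord0 i / h).
by rewrite ler_pdivlMr// ltr_pdivrMr// intrD mulrDl mul1r.
Qed.

(** Phrased with a measurable superset, since [F] is an arbitrary map and the image of [C] may fail
    to be measurable. *)
Definition small_image (F : 'rV[R]_n -> 'rV[R]_n) (g : 'rV[R]_n -> \bar R)
    (C : set 'rV[R]_n) :=
  exists2 T, measurable T &
    [set F y | y in C] `<=` T /\ (mu T <= \int[mu]_(y in C) g y)%E.

Lemma grid_image_bound (F : 'rV[R]_n -> 'rV[R]_n) (Omega : set 'rV[R]_n)
    (g : 'rV[R]_n -> \bar R) (h : R) : 0 < h ->
  measurable Omega -> measurable_fun Omega g ->
  (forall x, Omega x -> (0 <= g x)%E) ->
  exists2 U, measurable U &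
    (forall x, (exists2 z, cube (grid_corner h z) h x &
        cube (grid_corner h z) h `<=` Omega /\
        small_image F g (cube (grid_corner h z) h)) -> U (F x)) /\
    (mu U <= \int[mu]_(y in Omega) g y)%E.
Proof.
move=> h0 mO mg g0.
pose Q z := cube (grid_corner h z) h.
pose good z := Q z `<=` Omega /\ small_image F g (Q z).
(* Cubes are enumerated by [pickle]. The pair is a cover of the image and the cube itself when j
   codes a good cube, and two empty sets otherwise; the fourth clause yields disjointness of the
   cubes. *)
have TP (j : nat) : exists T : set 'rV[R]_n * set 'rV[R]_n,
  [/\ measurable T.1, measurable T.2 /\ T.2 `<=` Omega,
      (mu T.1 <= \int[mu]_(y in T.2) g y)%E,
      forall v, T.2 v -> exists2 z, pickle z = j & Q z v &
      forall z, good z -> pickle z = j -> [set F y | y in Q z] `<=` T.1].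
  have [[z [[zO [T mT [FT muT]]] zj]]|nz] := pselect (exists z, good z /\ pickle z = j).
    exists (T, Q z); split=> //=.
    - by split=> //; exact: measurable_cube.
    - by move=> v zv; exists z.
    - by move=> z' _; rewrite -zj => /(pcan_inj pickleK) ->.
  exists (set0, set0); split=> //=.
  - by split=> //; exact: sub0set.
  - by rewrite measure0 integral_set0.
  - by move=> z gz zj; exfalso; apply: nz; exists z.
have [T] := choice TP; rewrite {TP} => TP.
have mT1 j : measurable (T j).1 by have [] := TP j.
have mT2 j : measurable (T j).2 by have [_ []] := TP j.
have T2O : \bigcup_j (T j).2 `<=` Omega.
  by move=> v [j _]; have [_ [_]] := TP j => + _ _ _; exact.
have mUT1 : measurable (\bigcup_j (T j).1) by exact: bigcupT_measurable.
have mUT2 : measurable (\bigcup_j (T j).2) by exact: bigcupT_measurable.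
exists (\bigcup_j (T j).1) => //; split.
  move=> x [z zx gz]; exists (pickle z) => //.
  by have [_ _ _ _ /(_ z gz erefl)] := TP (pickle z); apply; exists x.
apply: (le_trans (generalized_Boole_inequality _ mT1 mUT1)).
apply: (@le_trans _ _ (\sum_(j <oo) \int[mu]_(y in (T j).2) g y)%E).
  by apply: lee_nneseries => [j _ _|j _]; [exact: measure_ge0|have [] := TP j].
rewrite -ge0_integral_bigcup//.
- by apply: ge0_subset_integral.
- exact: measurable_funS mg.
- by move=> x /T2O /g0.
move=> i j _ _ [v [iv jv]].
have [_ _ _ /(_ v iv)[z <- zv] _] := TP i.
have [_ _ _ /(_ v jv)[z' <- zv'] _] := TP j.
by rewrite ((cube_gridP _ _ h0).1 zv) ((cube_gridP _ _ h0).1 zv').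
Qed.

(** A point of [Gam] is covered only once h is small enough for that point, so the covers for h =
    1/(k+1) are combined into their lower limit. The sets [V N] increase and each lies in [U N], so
    the common bound passes to their union. *)
Lemma image_outer_bound (F : 'rV[R]_n -> 'rV[R]_n) (Gam Omega : set 'rV[R]_n)
    (g : 'rV[R]_n -> \bar R) :
  measurable Omega -> measurable_fun Omega g ->
  (forall x, Omega x -> (0 <= g x)%E) ->
  (forall x, Gam x -> exists2 r, 0 < r & forall h c, 0 < h -> h < r ->
     cube c h x -> cube c h `<=` Omega /\ small_image F g (cube c h)) ->
  exists2 U, measurable U & [set F x | x in Gam] `<=` U /\
    (mu U <= \int[mu]_(y in Omega) g y)%E.
Proof.
move=> mO mg g0 GamP.
have h0 (k : nat) : 0 < k.+1%:R^-1 :> R by rewrite invr_gt0.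
have UP k := grid_image_bound F (h0 k) mO mg g0.
have [U] := choice (fun k => (exists2P _ _).1 (UP k)).
rewrite {UP} => UP.
have mU k : measurable (U k) by have [] := UP k.
pose V N := \bigcap_(k in [set k | (N <= k)%N]) U k.
have mV N : measurable (V N) by apply: bigcap_measurable => //; exists N => /=.
have mUV : measurable (\bigcup_N V N) by exact: bigcupT_measurable.
exists (\bigcup_N V N) => //; split.
  move=> _ [x Gx <-]; have [r r0 xr] := GamP x Gx.
  have [N _ NP] := near_infty_natSinv_lt (PosNum r0).
  exists N => // k /= Nk; have [_ [+ _]] := UP k; apply.
  exists [ffun i => Num.floor (x ord0 i / k.+1%:R^-1)]; first exact/cube_gridP.
  by apply: xr => //; [exact: NP|exact/cube_gridP].
have cV : mu \o V @ \oo --> mu (\bigcup_N V N).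
  apply: nondecreasing_cvg_mu => // N M NM; apply/subsetPset => v NV k /= Mk.
  by apply: NV => /=; exact: leq_trans Mk.
rewrite -(cvg_lim _ cV)//; apply: lime_le; first exact: (cvgP _ cV).
apply: nearW => N /=; have [_ [_]] := UP N; apply: le_trans.
by rewrite le_measure ?inE// => v; apply=> /=.
Qed.

End covering.

(** * Measure of the image of points with semidefinite differential *)

Section gradient_image.
Variables (R : realType) (n : nat).
Notation mu := (lebesgue_row R n).

Lemma psd_prod_diag_le (H : 'M[R]_n) : psd H ->
  \prod_i H i i <= (\tr H / n%:R) ^+ n.
Proof.
move=> psdH; have := @leif_AGM R 'I_n predT (fun i => H i i).
by move=> /(_ (fun i _ => psd_diag i psdH))[]; rewrite card_ord.
Qed.

Lemma differential_image_bound (F : 'rV[R]_n -> 'rV[R]_n)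
    (H : 'rV[R]_n -> 'M[R]_n) (Gam Omega : set 'rV[R]_n) (g : 'rV[R]_n -> R)
    (eta : R) : open Omega ->
  measurable_fun Omega g -> (forall x, Omega x -> 0 <= g x) ->
  (forall x, Gam x -> [/\ Omega x, psd (H x), \prod_i H x i i <= g x,
     {for x, continuous g} &
     forall e, 0 < e -> \forall y \near x,
       `|F y - F x - (y - x) *m H x| <= e * `|y - x|]) ->
  0 < eta ->
  exists2 U, measurable U & [set F x | x in Gam] `<=` U /\
    (mu U <= \int[mu]_(y in Omega) (g y + eta)%:E)%E.
Proof.
move=> oO mg g0 GamP eta0.
(* One half of eta enlarges the linear image, the other absorbs the variation of [g] on the cube. *)
have e2 : 0 < eta / 2 by rewrite divr_gt0.
apply: image_outer_bound.
- exact: open_measurable_row.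
- by apply/measurable_EFinP; exact: measurable_funD.
- by move=> x Ox; rewrite lee_fin addr_ge0 ?g0// ltW.
move=> x Gx; have [Ox psdH Hg cg dF] := GamP x Gx.
have [r1 r10 xr1] := cube_image_bound psdH e2 dF.
have [r2 r20 xr2] := row_nbhsP (open_nbhs_nbhs (conj oO Ox)).
have [r3 r30 xr3] : exists2 r, 0 < r & forall y, `|y - x| < r -> `|g x - g y| < eta / 2.
  by apply: row_nbhsP; exact: (@cvgr_dist_lt _ _ _ _ (nbhs_filter x) g (g x) cg _ e2).
exists (Num.min r1 (Num.min r2 r3)); first by rewrite !lt_min r10 r20 r30.
move=> h c h0; rewrite !lt_min => /and3P[h1 h2 h3] cx.
have cO : cube c h `<=` Omega.
  by move=> y cy; apply: xr2; rewrite (lt_trans (cube_dist h0 cy cx)).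
split=> //; have [T mT [FT muT]] := xr1 h c h0 h1 cx.
exists T => //; split=> //; apply: (le_trans muT).
have mc := measurable_cube c h.
rewrite EFinM -(lebesgue_row_cube c h0) -integral_cst//.
apply: ge0_le_integral => //.
- move=> y _; rewrite lee_fin addr_ge0 ?(ltW e2)// prodr_ge0// => i _.
  exact: psd_diag.
- apply/measurable_EFinP; apply: measurable_funD => //.
  by apply: measurable_funS mg => //; exact: open_measurable_row.
move=> y cy; rewrite lee_fin.
have := xr3 y (lt_trans (cube_dist h0 cy cx) h3).
rewrite ltr_norml => /andP[_]; move: Hg; lra.
Qed.

End gradient_image.

(** * First- and second-order calculus *)

Section calculus.
Variables (R : realType) (n : nat).
Implicit Types (O : set 'rV[R]_n) (f : 'rV[R]_n -> R) (x y v p : 'rV[R]_n).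

(** Coordinate increments have unknown sign and may vanish; writing the intermediate point as c * s
    treats all cases at once. *)
Lemma MVT_theta (u du : R -> R) (s : R) :
  (forall t : R, `|t| <= `|s| -> is_derive t 1 u (du t)) ->
  exists2 c, 0 < c < 1 & u s - u 0 = s * du (c * s).
Proof.
move=> us; have [s0|s0|->] := ltgtP s 0; last first.
- by exists 2^-1; [apply/andP; split; lra|rewrite subrr mul0r].
- have [||c] := @MVT R u du 0 s s0.
  + move=> t; rewrite in_itv/= => /andP[t0 ts]; apply: us.
    by rewrite !gtr0_norm// ltW.
  + apply: derivable_within_continuous => t; rewrite in_itv/= => /andP[t0 ts].
    by have [] := us t; rewrite // !ger0_norm// ltW.
  rewrite in_itv/= subr0 => /andP[c0 cs] ->.
  exists (c / s); rewrite ?divr_gt0//= ?ltr_pdivrMr ?mul1r//.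
  by rewrite divfK ?gt_eqF// mulrC.
have [||c] := @MVT R u du s 0 s0.
  - move=> t; rewrite in_itv/= => /andP[t0 ts]; apply: us.
    by rewrite !ltr0_norm// lerN2 ltW.
  - apply: derivable_within_continuous => t; rewrite in_itv/= => /andP[t0 ts].
    by have [] := us t; rewrite // !ler0_norm// ?lerN2// ltW.
rewrite in_itv/= sub0r => /andP[c0 cs] uE.
exists (c / s); first by rewrite nmulr_rgt0// invr_lt0 s0/= ltr_ndivrMr// mul1r.
by rewrite divfK ?lt_eqF// -opprB uE mulrN opprK mulrC.
Qed.

Lemma is_derive_line f x v (t : R) : derivable f (x + t *: v) v ->
  is_derive t 1 (fun s => f (x + s *: v)) ('D_v f (x + t *: v)).
Proof.
move=> dfv.
have E : (fun h : R => h^-1 *: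
    (((fun s => f (x + s *: v)) \o shift t) (h *: 1) - f (x + t *: v))) =
         (fun h : R => h^-1 *: ((f \o shift (x + t *: v)) (h *: v) - f (x + t *: v))).
  apply/funext => h /=; congr (_ *: (f _ - _)).
  by rewrite [h *: 1]mulr1 scalerDl addrCA addrA [h *: v + x]addrC -addrA.
by apply: DeriveDef; rewrite /derivable /derive/= E.
Qed.

(** The gradient is a parameter, so that it can be negated together with f or replaced by a map that
    extends it to the closure. *)
Definition frechet_at f x (F : 'rV[R]_n) := forall e : R, 0 < e ->
  \forall y \near x, `|f y - f x - dotrow (y - x) F| <= e * `|y - x|.

Lemma dotrow_bound v p : `|dotrow v p| <= `|v| * \sum_i `|p ord0 i|.
Proof.
rewrite /dotrow (le_trans (ler_norm_sum _ _ _))// mulr_sumr ler_sum// => i _.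
by rewrite normrM ler_wpM2r// row_norm_coord.
Qed.

Lemma frechet_derivable f x v F : frechet_at f x F ->
  derivable f x v /\ 'D_v f x = dotrow v F.
Proof.
move=> dF.
have cf : (fun h : R => h^-1 *: ((f \o shift x) (h *: v) - f x)) @ 0^' --> dotrow v F.
  apply/cvgrPdist_le => e e0.
  have v1 : 0 < `|v| + 1 by rewrite ltr_wpDl.
  have [r r0 xr] := row_nbhsP (dF (e / (`|v| + 1)) (divr_gt0 e0 v1)).
  near=> h.
  have h0 : h != 0 by near: h; exact: nbhs_dnbhs_neq.
  have hr : `|h| < r / (`|v| + 1) by near: h; apply: dnbhs0_lt; exact: divr_gt0.
  have := xr (h *: v + x); rewrite addrK normrZ => H.
  have {H} : `|f (h *: v + x) - f x - dotrow (h *: v) F| <=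
      e / (`|v| + 1) * (`|h| * `|v|).
    apply: H; rewrite ltr_pdivlMr// in hr; apply: le_lt_trans hr.
    by rewrite ler_wpM2l// lerDl.
  rewrite dotrowZl /= => H.
  rewrite distrC [_ *: _]mulrC.
  have -> : (f (h *: v + x) - f x) * h^-1 - dotrow v F =
     (f (h *: v + x) - f x - h * dotrow v F) / h by field.
  rewrite normrM normfV ler_pdivrMr ?normr_gt0// (le_trans H)//.
  rewrite -mulrA ler_wpM2l ?(ltW e0)// mulrCA ler_piMr//.
  by rewrite mulrC ler_pdivrMr// mul1r lerDl.
split; first by apply/cvg_ex; exists (dotrow v F).
exact: cvg_lim cf.
Unshelve. all: by end_near. Qed.

Lemma frechet_line f x v (t : R) F : frechet_at f (x + t *: v) F ->
  is_derive t 1 (fun s => f (x + s *: v)) (dotrow v F).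
Proof.
by move=> /(frechet_derivable v)[dv <-]; exact: is_derive_line.
Qed.

Lemma frechet_C1 O f x : open O -> Ck_on 1 O f -> O x ->
  frechet_at f x (gradient f x).
Proof.
move=> oO [cf df] Ox e e0.
(* The n coordinate steps share e; dividing by n + 1 keeps e' positive when n = 0. *)
pose e' := e / n.+1%:R.
have e'0 : 0 < e' by rewrite divr_gt0.
have : \forall y \near x, forall k : 'I_n, `|partial k f x - partial k f y| < e'.
  apply: (@filter_forall _ _ (fun k => [set y | `|partial k f x - partial k f y| < e'])
    _ (nbhs_filter x)) => k; have [_ [/(_ x Ox) ck _]] := df k.
  exact: (@cvgr_dist_lt _ _ _ _ (nbhs_filter x) _ _ ck).
move=> /row_nbhsP[r1 r10 xr1].
have [r2 r20 xr2] := row_nbhsP (open_nbhs_nbhs (conj oO Ox)).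
apply: (@row_near _ _ _ _ (Num.min r1 r2)); first by rewrite lt_min r10 r20.
move=> y; rewrite lt_min => /andP[yr1 yr2].
(* [w k] has the first k coordinates of y and the others of x: the path changes one coordinate at a
   time and stays within distance |y - x| of x. *)
pose w (k : nat) : 'rV[R]_n := x + \row_i (if (i < k)%N then (y - x) ord0 i else 0).
have w0 : w 0%N = x by apply/rowP => i; rewrite !mxE addr0.
have wn : w n = y by apply/rowP => i; rewrite !mxE ltn_ord addrCA subrr addr0.
have wS (k : 'I_n) : w k.+1 = w k + (y - x) ord0 k *: basis_row R k.
  apply/rowP => i; rewrite !mxE eqxx/= ltnS leq_eqVlt -(inj_eq val_inj) eq_sym.
  case: eqVneq => [/val_inj->|_] /=; first by rewrite ltnn addr0 mulr1.
  by rewrite mulr0 addr0.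
have fw (k : 'I_n) :
    `|f (w k.+1) - f (w k) - (y - x) ord0 k * partial k f x| <= e' * `|y - x|.
  have near_w (t : R) : `|t| <= `|(y - x) ord0 k| ->
      `|w k + t *: basis_row R k - x| <= `|y - x|.
    move=> ty; apply/row_norm_leP => // i; rewrite !mxE eqxx/=.
    case: eqVneq => [->|_]; first rewrite ltnn addr0 mulr1 addrAC subrr add0r.
      by rewrite (le_trans ty)// row_norm_coord.
    rewrite mulr0 addr0 addrAC subrr add0r; case: ifP => _; last by rewrite normr0.
    by have := row_norm_coord (y - x) i; rewrite !mxE.
  have dw (t : R) : `|t| <= `|(y - x) ord0 k| ->
      is_derive t 1 (fun s => f (w k + s *: basis_row R k))
                    (partial k f (w k + t *: basis_row R k)).
    move=> ty; apply: is_derive_line; have [+ _] := df k; apply.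
    by apply: xr2; apply: le_lt_trans yr2; exact: near_w.
  have [c /andP[c0 c1]] := MVT_theta dw.
  rewrite /= scale0r addr0 -wS => ->.
  rewrite -mulrBr normrM mulrC ler_pM ?row_norm_coord//.
  rewrite distrC ltW// xr1//; apply: le_lt_trans yr1; apply: near_w.
  by rewrite normrM (gtr0_norm c0) ler_piMl// ltW.
have -> : f y - f x - dotrow (y - x) (gradient f x) =
    \sum_(k < n) (f (w k.+1) - f (w k) - (y - x) ord0 k * partial k f x).
  rewrite sumrB -(big_mkord predT (fun k => f (w k.+1) - f (w k))).
  rewrite (telescope_sumr (fun k => f (w k)))// w0 wn; congr (_ - _).
  by apply: eq_bigr => k _; rewrite [gradient f x _ _]mxE.
rewrite (le_trans (ler_norm_sum _ _ _))//.
rewrite (le_trans (ler_sum _ (fun k _ => fw k)))//.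
rewrite sumr_const card_ord -mulrnAl ler_wpM2r// /e' -mulr_natr -mulrA.
rewrite ler_piMr ?(ltW e0)//.
by rewrite mulrC ler_pdivrMr// mul1r ler_nat.
Qed.

End calculus.

(** * Hessians and interior minima *)

Section second_order.
Variables (R : realType) (n : nat).
Implicit Types (O : set 'rV[R]_n) (f : 'rV[R]_n -> R) (x y v p : 'rV[R]_n).

(** This order of indices makes [v *m hessian f x] the derivative of the gradient along v before
    symmetry is known. *)
Definition hessian f x : 'M[R]_n := \matrix_(j, i) partial j (partial i f) x.

Lemma row_norm_basis (i : 'I_n) : `|basis_row R i| <= 1.
Proof.
apply/row_norm_leP => // j; rewrite !mxE eqxx/=.
by case: eqVneq => _; rewrite ?normr1 ?normr0.
Qed.

(** Two mean values: along i for t -> f(x + s e_j + t e_i) - f(x + t e_i), then along j for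
    [partial i f]. All points involved are within 2 s of x. *)
Lemma second_difference O f x (r s : R) (i j : 'I_n) : Ck_on 2 O f ->
  (forall y, `|y - x| < r -> O y) -> 0 < s -> s + s < r ->
  exists2 z, `|z - x| < r &
    f (x + s *: basis_row R j + s *: basis_row R i) - f (x + s *: basis_row R i)
    - f (x + s *: basis_row R j) + f x = s ^+ 2 * partial j (partial i f) z.
Proof.
move=> [_ df] xr s0 sr.
set a := basis_row R i; set b := basis_row R j.
have nab (t u : R) : `|t| <= s -> `|u| <= s -> `|x + u *: b + t *: a - x| < r.
  move=> ts us; rewrite -(addrA x) addrAC subrr add0r.
  apply: le_lt_trans sr; rewrite (le_trans (ler_normD _ _))// !normrZ.
  by rewrite lerD// -[leRHS]mulr1 ler_pM// row_norm_basis.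
pose u (t : R) := f (x + s *: b + t *: a) - f (x + t *: a).
pose du (t : R) := partial i f (x + s *: b + t *: a) - partial i f (x + t *: a).
have us (t : R) : `|t| <= `|s| -> is_derive t 1 u (du t).
  rewrite (gtr0_norm s0) => ts; have [di _] := df i; apply: is_deriveB.
    by apply: is_derive_line; apply/di/xr/nab; rewrite // gtr0_norm.
  apply: is_derive_line; apply/di/xr.
  by have := nab t 0 ts; rewrite scale0r addr0 normr0; apply; exact: ltW.
have [c /andP[c0 c1] uE] := MVT_theta us.
have cs : `|c * s| <= s by rewrite normrM !gtr0_norm// ler_piMl// ltW.
have vs (t : R) : `|t| <= `|s| -> is_derive t 1
    (fun t => partial i f (x + (c * s) *: a + t *: b))
    (partial j (partial i f) (x + (c * s) *: a + t *: b)).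
  rewrite (gtr0_norm s0) => ts.
  have Oz : O (x + (c * s) *: a + t *: b) by rewrite addrAC; apply: xr; exact: nab.
  by have [_ [_ /(_ j)[/(_ _ Oz) dij _]]] := df i; exact: is_derive_line dij.
have [d /andP[d0 d1] vE] := MVT_theta vs.
exists (x + (c * s) *: a + (d * s) *: b).
  rewrite (addrAC x); apply: nab => //.
  by rewrite normrM !gtr0_norm// ler_piMl// ltW.
have -> : s ^+ 2 * partial j (partial i f) (x + (c * s) *: a + (d * s) *: b) =
    s * du (c * s).
  rewrite expr2 -mulrA -vE /du scale0r addr0; congr (_ * (partial i f _ - _)).
  by rewrite addrAC.
by rewrite -uE /u !scale0r !addr0; ring.
Qed.

(** The second difference is symmetric in i and j, so one mixed derivative at some y equals the
    other at some z, with y and z as close to x as desired; continuity at x concludes. *)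
Lemma hessian_sym O f x : open O -> Ck_on 2 O f -> O x ->
  (hessian f x)^T = hessian f x.
Proof.
move=> oO C2 Ox; apply/matrixP => j i; rewrite !mxE.
have cij k l : {for x, continuous (partial k (partial l f))}.
  by have [_ /(_ l)[_ [_ /(_ k)[_ [/(_ x Ox)]]]]] := C2.
apply/eqP; rewrite -subr_eq0 -normr_le0; apply/ler_addgt0Pl => e e0.
rewrite addr0.
have e2 : 0 < e / 2 by rewrite divr_gt0.
have [r1 r10 xr1] := row_nbhsP (@cvgr_dist_lt _ _ _ _ (nbhs_filter x) _ _ (cij j i) _ e2).
have [r2 r20 xr2] := row_nbhsP (@cvgr_dist_lt _ _ _ _ (nbhs_filter x) _ _ (cij i j) _ e2).
have [r3 r30 xr3] := row_nbhsP (open_nbhs_nbhs (conj oO Ox)).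
pose r := Num.min r1 (Num.min r2 r3).
have r0 : 0 < r by rewrite !lt_min r10 r20 r30.
have xr y : `|y - x| < r -> O y.
  by rewrite !lt_min => /and3P[_ _]; exact: xr3.
have [s s0 sr] : exists2 s, 0 < s & s + s < r.
  by exists (r / 3); [rewrite divr_gt0|lra].
have [y yr yE] := second_difference i j C2 xr s0 sr.
have [z zr zE] := second_difference j i C2 xr s0 sr.
have yz : partial j (partial i f) y = partial i (partial j f) z.
  apply: (@mulfI _ (s ^+ 2)); first by rewrite expf_neq0// gt_eqF.
  rewrite -yE -zE [x + s *: basis_row R j + _]addrAC; ring.
move: yr zr; rewrite !lt_min => /and3P[y1 _ _] /and3P[_ z2 _].
move: (xr1 y y1) (xr2 z z2); rewrite -yz.
move: (partial i (partial j f) x) (partial j (partial i f) x)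
  (partial j (partial i f) y) => A B C BC AC.
rewrite -(subrK C A) -addrA (le_trans (ler_normD _ _))// (splitr e) lerD ?ltW//.
by rewrite distrC.
Qed.

Lemma frechet_gradient O f x (e : R) : open O -> Ck_on 2 O f -> O x -> 0 < e ->
  \forall y \near x,
    `|gradient f y - gradient f x - (y - x) *m hessian f x| <= e * `|y - x|.
Proof.
move=> oO [_ df] Ox e0.
have : \forall y \near x, forall i : 'I_n, `|partial i f y - partial i f x -
    dotrow (y - x) (gradient (partial i f) x)| <= e * `|y - x|.
  apply: (@filter_forall _ _ (fun i => [set y | `|partial i f y - partial i f x -
    dotrow (y - x) (gradient (partial i f) x)| <= e * `|y - x|]) _ (nbhs_filter x)) => i.
  by have [_ dfi] := df i; exact: frechet_C1 dfi Ox e e0.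
apply: filterS => y yx; apply/row_norm_leP => [|i].
  by rewrite mulr_ge0// ltW.
apply: le_trans (yx i); rewrite !mxE le_eqVlt; apply/orP; left; apply/eqP.
congr `|_ - _|; apply: eq_bigr => j _; rewrite !mxE//.
Qed.

(** For the Hessian, the mean value theorem along x + t v gives 0 <= v . (F (x + c t v) - p). As F x
    = p, the expansion of F at x and division by c t turn this into v H . v >= - e. *)
Lemma minimum_second_order O f (F : 'rV[R]_n -> 'rV[R]_n) (H : 'M[R]_n) x p :
  open O -> O x -> (forall y, O y -> frechet_at f y (F y)) ->
  (forall e : R, 0 < e ->
    \forall y \near x, `|F y - F x - (y - x) *m H| <= e * `|y - x|) ->
  H^T = H ->
  (forall y, O y -> f x - dotrow x p <= f y - dotrow y p) ->
  F x = p /\ psd H.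
Proof.
move=> oO Ox dF dH symH xmin.
have [r r0 xr] := row_nbhsP (open_nbhs_nbhs (conj oO Ox)).
have small v : exists2 d, 0 < d & forall t : R, `|t| <= d -> O (x + t *: v).
  have v1 : 0 < `|v| + 1 by rewrite ltr_wpDl.
  exists (r / (`|v| + 1) / 2); first by rewrite !divr_gt0.
  move=> t td; apply: xr; rewrite addrAC subrr add0r normrZ.
  apply: (@le_lt_trans _ _ (`|t| * (`|v| + 1))).
    by rewrite ler_wpM2l// lerDl.
  rewrite -ltr_pdivlMr// (le_lt_trans td)//.
  have := divr_gt0 r0 v1; lra.
have lineF v (t : R) : O (x + t *: v) ->
    is_derive t 1 (fun s => f (x + s *: v) - dotrow (x + s *: v) p)
      (dotrow v (F (x + t *: v)) - dotrow v p).
  move=> Oxt; apply: is_deriveB; first exact/frechet_line/dF.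
  have := @frechet_line R n (fun u => dotrow u p) x v t p; apply => e e0.
  apply: (@row_near _ _ _ _ 1) => // y _.
  by rewrite (dotrowDl y) dotrowNl subrr normr0 mulr_ge0// ltW.
(* Otherwise a step along - (F x - p) would lower f - p . x at the rate |F x - p|^2. *)
have Fxp : F x = p.
  apply/eqP; rewrite -subr_eq0; apply/eqP/dotrow_eq0/eqP.
  rewrite eq_le dotrow_ge0 andbT; set v := F x - p.
  apply/ler_addgt0Pl => e e0; rewrite addr0.
  have v1 : 0 < `|v| + 1 by rewrite ltr_wpDl.
  have [d1 d10 xd1] := small v.
  have [d2 d20 xd2] := row_nbhsP (dF x Ox (e / (`|v| + 1)) (divr_gt0 e0 v1)).
  pose t := Num.min d1 (d2 / (`|v| + 1) / 2).
  have t0 : 0 < t by rewrite lt_min d10 !divr_gt0.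
  have td1 : t <= d1 by rewrite ge_min lexx.
  have td2 : t * (`|v| + 1) < d2.
    rewrite -ltr_pdivlMr//; apply: (@le_lt_trans _ _ (d2 / (`|v| + 1) / 2)).
      by rewrite ge_min lexx orbT.
    by have := divr_gt0 d20 v1; lra.
  have Oy : O (x + (- t) *: v) by apply: xd1; rewrite normrN gtr0_norm.
  have := xmin _ Oy.
  have := xd2 (x + (- t) *: v).
  rewrite addrAC subrr add0r normrZ normrN (gtr0_norm t0) => /(_ _)/wrap[].
    by apply: le_lt_trans td2; rewrite ler_wpM2l ?(ltW t0)// lerDl.
  rewrite dotrowZl dotrowDl !dotrowZl ler_norml => /andP[_ +] fm.
  set A := f _; set B := f x in fm *; move=> AB.
  have : t * dotrow v v <= e / (`|v| + 1) * (t * `|v|).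
    have -> : dotrow v v = dotrow v (F x) - dotrow v p by rewrite {2}/v dotrowDr dotrowNr.
    move: AB fm; rewrite -/A; lra.
  rewrite mulrCA ler_pM2l// => /le_trans; apply.
  by rewrite -mulrA ler_piMr ?(ltW e0)// mulrC ler_pdivrMr// mul1r lerDl.
split=> //; split=> // v.
apply/ler_addgt0Pl => e e0.
pose K := `|v| * \sum_i `|v ord0 i| + 1.
have K0 : 0 < K by rewrite ltr_wpDl// mulr_ge0// sumr_ge0.
have [d1 d10 xd1] := small v.
have [d2 d20 xd2] := row_nbhsP (dH (e / K) (divr_gt0 e0 K0)).
have v1 : 0 < `|v| + 1 by rewrite ltr_wpDl.
pose t := Num.min d1 (d2 / (`|v| + 1)).
have t0 : 0 < t by rewrite lt_min d10 !divr_gt0.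
have td1 : t <= d1 by rewrite ge_min lexx.
have td2 : t * (`|v| + 1) <= d2.
  by rewrite -ler_pdivlMr// ge_min lexx orbT.
have ut (s : R) : `|s| <= `|t| -> is_derive s 1
    (fun s => f (x + s *: v) - dotrow (x + s *: v) p)
      (dotrow v (F (x + s *: v)) - dotrow v p).
  rewrite (gtr0_norm t0) => st; apply: lineF; apply: xd1.
  exact: le_trans td1.
have [c /andP[c0 c1]] := MVT_theta ut.
have ct0 : 0 < c * t by rewrite mulr_gt0.
have ctt : c * t < t by rewrite gtr_pMl.
rewrite /= scale0r addr0 => uE.
have : 0 <= t * (dotrow v (F (x + (c * t) *: v)) - dotrow v p).
  rewrite -uE subr_ge0 xmin//; apply: xd1.
  by rewrite gtr0_norm.
rewrite pmulr_rge0// -dotrowNr -dotrowDr -Fxp => h.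
have := xd2 (x + (c * t) *: v).
rewrite addrAC subrr add0r normrZ (gtr0_norm ct0) => /(_ _)/wrap[].
  apply: lt_le_trans td2; apply: (@le_lt_trans _ _ (t * `|v|)).
    by rewrite ler_wpM2r// ltW.
  by rewrite ltr_pM2l// ltrDl.
set w := F _ - F x in h *; rewrite -scalemxAl => wb.
have := dotrow_bound (w - (c * t) *: (v *m H)) v.
move/le_trans => /(_ _ (ler_wpM2r _ wb)) => /(_ (sumr_ge0 _ (fun i _ => normr_ge0 _))).
rewrite dotrowDl dotrowNl dotrowZl ler_norml => /andP[_].
rewrite (dotrowC w) => {}wb.
have {}wb : - (c * t * dotrow (v *m H) v) <= c * t * (e / K * (K - 1)).
  rewrite /K addrK; move: wb h; lra.
rewrite -mulrN ler_pM2l// in wb.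
have : e / K * (K - 1) <= e.
  by rewrite -mulrA ler_piMr ?(ltW e0)// mulrC ler_pdivrMr// mul1r gerBl.
move: wb; lra.
Qed.

End second_order.

(** * The gradient at the boundary *)

Section boundary.
Variables (R : realType) (n : nat).
Implicit Types (O : set 'rV[R]_n) (f : 'rV[R]_n -> R) (x y v w p nu : 'rV[R]_n).

Lemma enorm_ge0 v : 0 <= enorm v.
Proof. exact: sqrtr_ge0. Qed.

Lemma enorm_sqr v : enorm v ^+ 2 = dotrow v v.
Proof. by rewrite sqr_sqrtr// dotrow_ge0. Qed.

Lemma enorm_le v : enorm v <= n.+1%:R * `|v|.
Proof.
rewrite -(@ler_pXn2r _ 2)// ?nnegrE ?enorm_ge0 ?mulr_ge0// enorm_sqr.
rewrite (le_trans (ler_norm _))// (le_trans (dotrow_bound _ _))//.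
have -> : (n.+1%:R * `|v|) ^+ 2 = `|v| * (n.+1%:R ^+ 2 * `|v|) by ring.
rewrite ler_wpM2l//.
apply: (@le_trans _ _ (\sum_(i < n) `|v|)).
  by apply: ler_sum => i _; exact: row_norm_coord.
rewrite sumr_const card_ord -[leLHS]mulr_natl ler_wpM2r//.
by rewrite -natrX ler_nat (leq_trans (leqnSn n))// expnS leq_pmulr// expn_gt0.
Qed.

(** On the segment O and its closure coincide, so the parameters in O form a nonempty open and
    closed part of [0, 1]. *)
Lemma segment_in_open O x w : open O -> O x ->
  (forall s : R, 0 <= s <= 1 -> ~ boundary O (x + s *: w)) -> O (x + w).
Proof.
move=> oO Ox nb; pose g (s : R) : 'rV[R]_n := x + s *: w.
have cg : continuous g.
  move=> s; apply: cvgD; first exact: cvg_cst.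
  exact: scalel_continuous.
have := @segment_connected R 0 1 (`[0, 1]%classic `&` g @^-1` O).
have -> : x + w = g 1 by rewrite /g scale1r.
have I1 : `[0, 1]%classic (1 : R) by rewrite /= in_itv/= ler01 lexx.
move=> H; suff : (`[0, 1]%classic `&` g @^-1` O) 1 by case.
rewrite H//.
- by exists 0; split; [rewrite /= in_itv/= lexx ler01|rewrite /= /g scale0r addr0].
- by exists (g @^-1` O) => //; apply: open_comp => // s _; exact: cg.
exists (g @^-1` closure O).
  by apply: closed_comp => [s _|]; [exact: cg|exact: closed_closure].
apply/seteqP; split => s [/= s01 gs]; split => //; first exact: subset_closure.
have [//|nO] := pselect (O (g s)); exfalso; apply: (nb s).
  by move: s01; rewrite in_itv.
by split=> //; rewrite ((interior_id O).1 oO).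
Qed.

(** The point x - t nu lies in O. On the segment from it to x + t w, (y - x) . nu is at most - t a
    with a = min(1, - w . nu), whereas tangency bounds it by t a / 2 in absolute value at boundary
    points. So the segment never meets the boundary. *)
Lemma inward_cone O x nu w : open O -> outward_unit_normal_at O x nu ->
  dotrow w nu < 0 ->
  exists2 d, 0 < d & forall t : R, 0 < t -> t < d -> O (x + t *: w).
Proof.
move=> oO [nu1 tang inn _] wnu.
have nn : dotrow nu nu = 1 by rewrite -enorm_sqr nu1 expr1n.
pose a := Num.min 1 (- dotrow w nu).
have a0 : 0 < a by rewrite lt_min ltr01 oppr_gt0.
pose D := `|w| + `|nu| + 1.
have D0 : 0 < D by rewrite ltr_wpDl// addr_ge0.
have nD : 0 < n.+1%:R * D by rewrite mulr_gt0.
(* On that segment the Euclidean length of y - x is at most t (n + 1) D. *)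
pose e := a / 2 / (n.+1%:R * D).
have e0 : 0 < e by rewrite !divr_gt0.
have [r r0 xr] := row_nbhsP (tang e e0).
have [d1 d10 xd1] : exists2 d, 0 < d & forall t : R, 0 < t -> t < d -> O (x - t *: nu).
  have [d /= d0 dP] := inn; exists d => // t t0 td; apply: dP => //=.
  by rewrite sub0r normrN gtr0_norm.
exists (Num.min d1 (r / D)); first by rewrite lt_min d10 divr_gt0.
move=> t t0; rewrite lt_min => /andP[td1 tr].
have -> : x + t *: w = (x - t *: nu) + t *: (w + nu).
  by rewrite scalerDr addrACA [- _ + _]addrC subrr addr0.
apply: segment_in_open => //; first exact: xd1.
move=> s /andP[s0 s1] bd.
set y := _ + s *: _ in bd.
have yx : y - x = t *: (s *: w + (s - 1) *: nu).
  by rewrite /y; apply/rowP => i; rewrite !mxE; ring.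
have ynu : dotrow (y - x) nu = t * (s * dotrow w nu + (s - 1)).
  by rewrite yx dotrowZl dotrowDl !dotrowZl nn mulr1.
have yD : `|y - x| <= t * D.
  rewrite yx normrZ (gtr0_norm t0) ler_wpM2l ?(ltW t0)//.
  rewrite (le_trans (ler_normD _ _))// !normrZ (ger0_norm s0) ler0_norm ?subr_le0//.
  have := normr_ge0 w; have := normr_ge0 nu => h1 h2.
  rewrite /D -addrA lerD// ?ler_piMl// (@le_trans _ _ `|nu|)// ?lerDl//.
  by rewrite ler_piMl// opprB gerBl.
have := xr y _ bd; rewrite ltr_pdivlMr// in tr.
move=> /(_ (le_lt_trans yD tr)).
rewrite ynu normrM (gtr0_norm t0) => H.
have {}H : t * `|s * dotrow w nu + (s - 1)| <= t * (a / 2).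
  apply: (le_trans H); apply: (@le_trans _ _ (e * (n.+1%:R * (t * D)))).
    by rewrite ler_wpM2l ?(ltW e0)// (le_trans (enorm_le _))// ler_wpM2l.
  by rewrite (mulrCA _ t) /e [_ * (t * _)]mulrCA divfK// gt_eqF.
move: H; rewrite ler_pM2l// ler_norml => /andP[H _].
have a1 : a <= 1 by rewrite ge_min lexx.
have a2 : a <= - dotrow w nu by rewrite ge_min lexx orbT.
have : s * a <= s * - dotrow w nu by rewrite ler_wpM2l.
have : (1 - s) * a <= (1 - s) * 1 by rewrite ler_wpM2l// subr_ge0.
by move: a0 H; lra.
Qed.

(* Both one-sided bounds hold along every inward direction w, hence
   `|G x . w| <= - p . w; the choice w = +- G x then bounds G x by p without
   using that G x is normal to the boundary. *)
Lemma boundary_gradient_le O f (G : 'rV[R]_n -> 'rV[R]_n) x nu p : open O ->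
  closure O x -> outward_unit_normal_at O x nu ->
  (forall y, O y -> frechet_at f y (G y)) ->
  {within closure O, continuous G} ->
  (forall y, O y -> `|f y| <= dotrow (x - y) p) ->
  enorm (G x) <= enorm p.
Proof.
move=> oO cOx xnu dG cG fp.
have inward w : dotrow w nu < 0 -> `|dotrow w (G x)| <= - dotrow w p.
  move=> wnu; apply/ler_addgt0Pl => e e0.
  pose S := \sum_i `|w ord0 i| + 1.
  have S0 : 0 < S by rewrite ltr_wpDl// sumr_ge0.
  pose W := `|w| + 1.
  have W0 : 0 < W by rewrite ltr_wpDl.
  have [d d0 xd] := inward_cone oO xnu wnu.
  have [r r0 xr] : exists2 r, 0 < r & forall y, `|y - x| < r -> O y ->
      `|G x - G y| < e / 2 / S.
    have e20 : 0 < e / 2 / S by rewrite !divr_gt0.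
    have : nbhs_subspace (A := closure O) x [set y | `|G x - G y| < e / 2 / S].
      exact: (@cvgr_dist_lt _ _ _ _ (nbhs_filter _) _ _ (cG x) _ e20).
    rewrite -nbhs_subspace_in// => H.
    have [r r0 xr] := row_nbhsP H; exists r => // y yr Oy.
    by apply: (xr y yr); exact: subset_closure.
  pose t := Num.min (d / 2) (r / W) / 2.
  have t0 : 0 < t by rewrite divr_gt0// lt_min !divr_gt0.
  (* [MVT_theta] asks for derivatives on both sides of its base point x + t w, so the ray is used up
     to parameter 2 t. *)
  have td : t + t < d.
    have : Num.min (d / 2) (r / W) <= d / 2 by rewrite ge_min lexx.
    by rewrite /t; lra.
  have tr : (t + t) * W <= r.
    by rewrite -ler_pdivlMr// /t -splitr ge_min lexx orbT.
  (* The mean value is taken between two points of O, where f is differentiable, with f bounded at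
     both ends; s / t tending to 0 will give the claim. *)
  have del (s : R) : 0 < s -> s < t ->
      (t - s) * `|dotrow w (G x)| <= - (t + s) * dotrow w p + (t - s) * (e / 2).
    move=> s0 st.
    have ut (q : R) : `|q| <= `|- (t - s)| -> is_derive q 1
        (fun q => f (x + t *: w + q *: w)) (dotrow w (G (x + t *: w + q *: w))).
      rewrite normrN [`|t - s|]gtr0_norm ?subr_gt0// ler_norml => /andP[q1 q2].
      apply: frechet_line; apply: dG.
      by rewrite -addrA -scalerDl; apply: xd; lra.
    have [c /andP[c0 c1]] := MVT_theta ut.
    set q := c * _; rewrite scale0r addr0 => uE.
    have q1 : - (t - s) < q.
      by rewrite /q mulrN ltrN2 gtr_pMl// subr_gt0.
    have q2 : q < 0 by rewrite /q mulrN oppr_lt0 mulr_gt0// subr_gt0.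
    have Oq : O (x + t *: w + q *: w) by rewrite -addrA -scalerDl; apply: xd; lra.
    have Gq : `|G x - G (x + t *: w + q *: w)| < e / 2 / S.
      apply: xr => //; rewrite -(addrA x) -scalerDl addrAC subrr add0r normrZ.
      rewrite gtr0_norm; last by lra.
      apply: lt_le_trans tr; apply: (@le_lt_trans _ _ ((t + t) * `|w|)).
        by rewrite ler_wpM2r//; lra.
      by rewrite ltr_pM2l ?addr_gt0// ltrDl.
    have fs : `|f (x + s *: w)| <= - s * dotrow w p.
      have := fp _ (xd s s0 ltac:(lra)).
      by rewrite opprD addrA subrr add0r dotrowNl dotrowZl mulNr.
    have ft : `|f (x + t *: w)| <= - t * dotrow w p.
      have := fp _ (xd t t0 ltac:(lra)).
      by rewrite opprD addrA subrr add0r dotrowNl dotrowZl mulNr.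
    have sE : x + t *: w + (- (t - s)) *: w = x + s *: w.
      by rewrite -addrA -scalerDl; congr (_ + _ *: _); ring.
    rewrite sE in uE.
    have Gw : `|dotrow w (G x) - dotrow w (G (x + t *: w + q *: w))| <= e / 2.
      rewrite -dotrowNr -dotrowDr dotrowC (le_trans (dotrow_bound _ _))//.
      apply: (@le_trans _ _ (e / 2 / S * (S - 1))).
        by rewrite /S addrK ler_wpM2r ?sumr_ge0// ltW.
      rewrite -mulrA ler_piMr ?divr_ge0 ?(ltW e0)// mulrC ler_pdivrMr// mul1r.
      by rewrite gerBl.
    have ts : 0 < t - s by rewrite subr_gt0.
    rewrite -{1}(gtr0_norm ts) -normrM.
    have -> : (t - s) * dotrow w (G x) = f (x + t *: w) - f (x + s *: w) +
       (t - s) * (dotrow w (G x) - dotrow w (G (x + t *: w + q *: w))).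
      by rewrite -[f _ - f _]opprB uE; ring.
    rewrite (le_trans (ler_normD _ _))// lerD//; last first.
      by rewrite normrM (gtr0_norm ts) ler_pM2l.
    rewrite (le_trans (ler_normB _ _))//.
    by move: fs ft; lra.
  pose A := `|dotrow w (G x)|; pose B := - dotrow w p.
  have A0 : 0 <= A by exact: normr_ge0.
  have Wp : 0 < A + `|B| + e by rewrite ltr_wpDl// addr_ge0.
  (* For s = th t the terms carrying th amount to at most e / 2. *)
  pose th := e / (2 * (A + `|B| + e)).
  have th0 : 0 < th by rewrite divr_gt0// mulr_gt0.
  have thE : th * (A + `|B| + e) = e / 2 by rewrite /th; field; rewrite gt_eqF.
  have th1 : th < 1.
    rewrite /th ltr_pdivrMr ?mulr_gt0// mul1r.
    by have := normr_ge0 B; lra.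
  have := del (th * t); rewrite mulr_gt0// gtr_pMl// => /(_ isT th1).
  have -> : (t - th * t) * A = t * ((1 - th) * A) by ring.
  have -> : - (t + th * t) * dotrow w p + (t - th * t) * (e / 2) =
     t * ((1 + th) * B + (1 - th) * (e / 2)) by rewrite /B; ring.
  rewrite ler_pM2l//.
  have := ler_norm B; rewrite -(ler_pM2l th0) => h1.
  have := th0; rewrite -(ltr_pM2r e0) mul0r => h2.
  move: thE; rewrite !mulrDr -/A -/B; lra.
(* Directions orthogonal to nu are limits of the strictly inward directions w - (e / K) nu. *)
have inward0 w : dotrow w nu <= 0 -> `|dotrow w (G x)| <= - dotrow w p.
  move=> wnu; apply/ler_addgt0Pl => e e0.
  pose K := `|dotrow nu (G x)| + `|dotrow nu p| + 1.
  have K0 : 0 < K by rewrite ltr_wpDl// addr_ge0.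
  have eK : 0 < e / K by rewrite divr_gt0.
  have [nu1 _ _ _] := xnu.
  have nn : dotrow nu nu = 1 by rewrite -enorm_sqr nu1 expr1n.
  have := inward (w - (e / K) *: nu).
  rewrite !dotrowDl !dotrowNl !dotrowZl nn mulr1 => /(_ _)/wrap[].
    by rewrite subr_lt0 (le_lt_trans wnu).
  have eKE : e / K * K = e by rewrite divfK// gt_eqF.
  have h1 : e / K * dotrow nu p <= e / K * `|dotrow nu p|.
    by rewrite ler_pM2l// ler_norm.
  have := lerB_dist (dotrow w (G x)) (e / K * dotrow nu (G x)).
  rewrite normrM (gtr0_norm eK).
  by move: eKE; rewrite {2}/K !mulrDr; lra.
have [w wE wnu] : exists2 w, w = G x \/ w = - G x & dotrow w nu <= 0.
  have [h|h] := leP (dotrow (G x) nu) 0; first by exists (G x) => //; left.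
  by exists (- G x); [right|rewrite dotrowNl oppr_le0 ltW].
have ww : dotrow (G x) (G x) = dotrow w w.
  by case: wE => ->//; rewrite dotrowNl dotrowNr opprK.
have := inward0 w wnu.
have -> : `|dotrow w (G x)| = dotrow w w.
  by case: wE => ->; rewrite ?dotrowNl ?dotrowNr ?normrN ?opprK ger0_norm// dotrow_ge0.
move=> h; rewrite -(@ler_pXn2r _ 2)// ?nnegrE ?enorm_ge0// !enorm_sqr ww.
(* Together with |w|^2 <= - w . p, the inequality |w + p|^2 >= 0 gives |w|^2 <= |p|^2. *)
have := dotrow_ge0 (w + p); rewrite dotrowDl !dotrowDr (dotrowC p).
by move: h; lra.
Qed.

End boundary.

(** * Contact points *)

Section contact.
Variables (R : realType) (n : nat).
Implicit Types (O : set 'rV[R]_n) (f : 'rV[R]_n -> R).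

Lemma bounded_closure_compact O : bounded_set O -> compact (closure O).
Proof.
move=> [M [Mreal OM]]; apply: bounded_closed_compact; last exact: closed_closure.
exists M; split=> // N MN v cOv; apply/ler_addgt0Pl => e e0.
have [w [Ow vw]] : (O `&` [set w | `|w - v| < e]) !=set0.
  by apply: cOv; exact: (@row_near _ _ _ _ e).
rewrite -(subrK w v) (le_trans (ler_normD _ _))// lerD//; last exact: OM.
by rewrite distrC ltW.
Qed.

(* The hypotheses on f that are stable under negation: both phi and - phi are
   used, since phi may change sign near the boundary. *)
Definition C2_closure O f (F : 'rV[R]_n -> 'rV[R]_n) (H : 'rV[R]_n -> 'M[R]_n) :=
  [/\ forall y, O y -> frechet_at f y (F y),
      forall x (e : R), O x -> 0 < e -> \forall y \near x,
        `|F y - F x - (y - x) *m H x| <= e * `|y - x|,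
      forall x, O x -> (H x)^T = H x &
      {within closure O, continuous f}].

Lemma C2_closureN O f F H : C2_closure O f F H ->
  C2_closure O (fun x => - f x) (fun x => - F x) (fun x => - H x).
Proof.
move=> [dF dH sH cf]; split.
- move=> y Oy e e0; apply: filterS (dF y Oy e e0) => z.
  by rewrite dotrowNr -!opprD normrN.
- move=> x e Ox e0; apply: filterS (dH x e Ox e0) => z.
  by rewrite mulmxN -!opprD normrN.
- by move=> x Ox; rewrite linearN/= sH.
- by move=> x; apply: continuousN; exact: cf.
Qed.

Lemma dotrow_continuous (p : 'rV[R]_n) : continuous (fun v => dotrow v p).
Proof.
move=> v; apply/(@cvgrPdist_lt _ _ _ _ (nbhs_filter v)) => e e0.
pose C := \sum_i `|p ord0 i| + 1.
have C0 : 0 < C by rewrite ltr_wpDl// sumr_ge0.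
apply: (@row_near _ _ _ _ (e / C)); first by rewrite divr_gt0.
move=> w; rewrite ltr_pdivlMr// => wv.
rewrite distrC -dotrowNl -dotrowDl; apply: le_lt_trans wv.
by rewrite (le_trans (dotrow_bound _ _))// ler_wpM2l// lerDl.
Qed.

Lemma exists_minimum O f F H p : open O -> compact (closure O) -> O !=set0 ->
  C2_closure O f F H ->
  exists2 x, closure O x &
    (forall y, closure O y -> f x - dotrow x p <= f y - dotrow y p) /\
    (O x -> F x = p /\ psd (H x)).
Proof.
move=> oO cO [x0 Ox0] [dF dH sH cf].
have cO0 : closure O !=set0 by exists x0; exact: subset_closure.
have cfp : {within closure O, continuous (fun x => f x - dotrow x p)}.
  apply: within_continuousB => //; apply: continuous_subspaceT.
  exact: dotrow_continuous.
have [x xO xmin] := EVT_min_rV cO0 cO cfp.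
have cx : closure O x by exact: set_mem.
have {}xmin y : closure O y -> f x - dotrow x p <= f y - dotrow y p.
  by move=> cy; apply: xmin; exact: mem_set.
exists x => //; split=> // Ox.
apply: (@minimum_second_order _ _ O f F (H x)) => //.
- by move=> e e0; exact: dH.
- exact: sH.
- by move=> y Oy; apply: xmin; exact: subset_closure.
Qed.

Lemma gradient_ball_cover O f F H (G : 'rV[R]_n -> 'rV[R]_n)
    (nu : 'rV[R]_n -> 'rV[R]_n) (m : R) p :
  open O -> compact (closure O) -> O !=set0 ->
  outward_unit_normal O nu -> C2_closure O f F H ->
  {within closure O, continuous G} -> (forall x, O x -> G x = F x) ->
  (forall x, boundary O x -> f x = 0) ->
  (forall x, boundary O x -> m <= enorm (G x)) -> enorm p < m ->
  (exists2 x, O x & F x = p /\ psd (H x)) \/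
  (exists2 x, O x & - F x = p /\ psd (- H x)).
Proof.
move=> oO cO O0 nuO C2f cG GF f0 mG pm.
have [x1 cx1 [min1 in1]] := exists_minimum p oO cO O0 C2f.
have [x2 cx2 [min2 in2]] := exists_minimum p oO cO O0 (C2_closureN C2f).
have [Ox1|nOx1] := pselect (O x1); first by left; exists x1 => //; exact: in1.
have [Ox2|nOx2] := pselect (O x2); first by right; exists x2 => //; exact: in2.
have bx1 : boundary O x1 by split=> //; rewrite ((interior_id O).1 oO).
have bx2 : boundary O x2 by split=> //; rewrite ((interior_id O).1 oO).
have x12 : dotrow x1 p = dotrow x2 p.
  apply/eqP; rewrite eq_le.
  have := min1 x2 cx2; have := min2 x1 cx1.
  by rewrite !f0// oppr0 !sub0r !lerN2 => -> ->.
have [dF _ _ _] := C2f.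
have := @boundary_gradient_le _ _ O f G x1 (nu x1) p oO cx1 (nuO _ bx1).
rewrite leNgt (lt_le_trans pm (mG _ bx1)) => H'; suff : false by [].
apply: H' => // y Oy; first by rewrite GF//; exact: dF.
have cy := subset_closure Oy.
have := min1 y cy; have := min2 y cy; rewrite (f0 _ bx1) (f0 _ bx2) -x12.
by rewrite dotrowDl dotrowNl ler_norml => h1 h2; apply/andP; split; lra.
Qed.

End contact.

(** * The integral estimate and the sign of the eigenvalue *)

Section integral_bound.
Variables (R : realType) (n : nat).
Notation mu := (lebesgue_row R n).
Implicit Types (O : set 'rV[R]_n) (f : 'rV[R]_n -> R).

Lemma open_continuous_measurable O f : open O ->
  (forall x, O x -> {for x, continuous f}) -> measurable_fun O f.
Proof.
move=> oO cf; apply: (measurability _ (RGenOInfty.measurableE R)).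
move=> _ [_ [a ->] <-]; apply: open_measurable_row.
rewrite openE => x [Ox /=]; rewrite in_itv/= andbT => fa.
apply: filterI; first exact: open_nbhs_nbhs.
have /cf/(_ `]a, +oo[%classic) := Ox; apply.
by apply: open_nbhs_nbhs; split; [exact: interval_open|rewrite /= in_itv/= andbT].
Qed.

(** The n-th power of the positive part of c f: an integrand that is nonnegative and continuous off
    the contact set too. The form (|t| + t) / 2 makes continuity immediate. *)
Definition pos_part_pow (c : R) f : 'rV[R]_n -> R :=
  fun x => ((`|c * f x| + c * f x) / 2) ^+ n.

Lemma pos_part_pow_ge0 c f x : 0 <= pos_part_pow c f x.
Proof.
rewrite exprn_ge0// divr_ge0//.
by have := ler_norm (- (c * f x)); rewrite normrN lerNl -subr_ge0 opprK addrC.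
Qed.

Lemma pos_part_powE c f x : 0 <= c * f x -> pos_part_pow c f x = (c * f x) ^+ n.
Proof. by move=> cf; rewrite /pos_part_pow ger0_norm//; congr (_ ^+ n); lra. Qed.

(** The two positive parts are never both nonzero, and [0 < n] makes the power of the vanishing one
    zero. *)
Lemma pos_part_powD c f x : (0 < n)%N ->
  pos_part_pow c f x + pos_part_pow (- c) f x = (`|c| * `|f x|) ^+ n.
Proof.
move=> n0; rewrite /pos_part_pow mulNr normrN -normrM.
have [h|h] := leP 0 (c * f x).
  by rewrite ger0_norm// subrr mul0r [0 ^+ n]expr0n gtn_eqF// addr0; congr (_ ^+ n); lra.
by rewrite ltr0_norm// addNr mul0r [0 ^+ n]expr0n gtn_eqF// add0r; congr (_ ^+ n); lra.
Qed.

Lemma continuous_pos_part_pow c f x : {for x, continuous f} ->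
  {for x, continuous (pos_part_pow c f)}.
Proof.
move=> cf.
have ccf : {for x, continuous (fun x => c * f x)}.
  by apply: continuousM => //; exact: cst_continuous.
have cpf : {for x, continuous (fun x => `|c * f x| + c * f x)}.
  by apply: continuousD => //; exact: (continuous_comp ccf (@norm_continuous _ _ _)).
have cpf2 : {for x, continuous (fun x => (`|c * f x| + c * f x) / 2)}.
  by apply: continuousM => //; exact: cst_continuous.
exact: (continuous_comp cpf2 (@exprn_continuous _ n _)).
Qed.

Definition enorm_ball (r : R) : set 'rV[R]_n := [set p | enorm p < r].

(** The images for f and - f are bounded with the positive parts of c f and - c f, whose n-th powers
    add up to |c f|^n; the two-sided cover thus costs no factor 2. *)
Lemma abp_bound O f F H (G : 'rV[R]_n -> 'rV[R]_n) (nu : 'rV[R]_n -> 'rV[R]_n)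
    (lambda m : R) : (0 < n)%N ->
  open O -> compact (closure O) -> O !=set0 -> (mu O < +oo)%E ->
  outward_unit_normal O nu -> C2_closure O f F H ->
  (forall x, O x -> {for x, continuous f}) ->
  (forall x, O x -> - \tr (H x) = lambda * f x) ->
  {within closure O, continuous G} -> (forall x, O x -> G x = F x) ->
  (forall x, boundary O x -> f x = 0) ->
  (forall x, boundary O x -> m <= enorm (G x)) ->
  measurable (enorm_ball m) ->
  (mu (enorm_ball m) <=
   \int[mu]_(x in O) ((`|lambda / n%:R| * `|f x|) ^+ n)%:E)%E.
Proof.
move=> n0 oO cO O0 Ooo nuO C2f cf eqf cG GF f0 mG mB.
have nR : 0 < n%:R :> R by rewrite ltr0n.
have mO : measurable O by exact: open_measurable_row.
have mg c : measurable_fun O (pos_part_pow c f).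
  apply: open_continuous_measurable => // x Ox.
  exact/continuous_pos_part_pow/cf.
(* By the equation, c f is the mean of the diagonal of H, hence nonnegative where H is
   semidefinite. *)
pose c := - (lambda / n%:R).
have image_bound (F' : 'rV[R]_n -> 'rV[R]_n) (H' : 'rV[R]_n -> 'M[R]_n) d (eta : R) :
  (forall x (e : R), O x -> 0 < e -> \forall y \near x,
        `|F' y - F' x - (y - x) *m H' x| <= e * `|y - x|) ->
  (forall x, O x -> \tr (H' x) / n%:R = d * f x) -> 0 < eta ->
  exists2 U, measurable U & [set F' x | x in [set x | O x /\ psd (H' x)]] `<=` U /\
    (mu U <= \int[mu]_(y in O) (pos_part_pow d f y + eta)%:E)%E.
  move=> dH trH eta0; apply: (@differential_image_bound _ _ F' H') => //.
    by move=> x _; exact: pos_part_pow_ge0.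
  move=> x [Ox psdH]; split => //.
  - have trH0 : 0 <= \tr (H' x) by rewrite sumr_ge0// => i _; exact: psd_diag.
    rewrite (le_trans (psd_prod_diag_le psdH))// trH// pos_part_powE//.
    by rewrite -trH// divr_ge0// ltW.
  - exact/continuous_pos_part_pow/cf.
  - by move=> e e0; exact: dH.
have mh : measurable_fun O (fun x => (`|lambda / n%:R| * `|f x|) ^+ n).
  apply: measurable_funX; apply: measurable_funM => //.
  by apply: measurableT_comp => //; exact: open_continuous_measurable.
apply/lee_addgt0Pr => e e0.
pose M := fine (mu O) + 1.
have muO : mu O = (fine (mu O))%:E by rewrite fineK// ge0_fin_numE.
have M0 : 0 < M by rewrite ltr_wpDl// fine_ge0.
(* Each of the two covers contributes eta times the measure of [O], which is less than [M]. *)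
pose eta := e / M / 2.
have eta0 : 0 < eta by rewrite !divr_gt0.
have [_ dH _ _] := C2f; have [_ dHN _ _] := C2_closureN C2f.
have [|U1 mU1 [FU1 muU1]] := image_bound F H c eta dH _ eta0.
  by move=> x Ox; rewrite -[\tr _]opprK eqf// /c; ring.
have [|U2 mU2 [FU2 muU2]] := image_bound _ _ (- c) eta dHN _ eta0.
  by move=> x Ox; rewrite linearN/= eqf// /c; ring.
have BU : (enorm_ball m) `<=` U1 `|` U2.
  move=> p pm; have [[x Ox [Fx Hx]]|[x Ox [Fx Hx]]] :=
    gradient_ball_cover oO cO O0 nuO C2f cG GF f0 mG pm.
    by left; apply: FU1; exists x.
  by right; apply: FU2; exists x.
have mU12 : measurable (U1 `|` U2) by exact: measurableU.
apply: (@le_trans _ _ (mu (U1 `|` U2))); first by rewrite le_measure ?inE.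
apply: (@le_trans _ _ (mu U1 + mu U2)%E).
  exact: measureU2.
apply: (le_trans (leeD muU1 muU2)).
rewrite -ge0_integralD//; last 4 first.
- by move=> x _; rewrite lee_fin addr_ge0 ?(ltW eta0)// pos_part_pow_ge0.
- by apply/measurable_EFinP; exact: measurable_funD.
- by move=> x _; rewrite lee_fin addr_ge0 ?(ltW eta0)// pos_part_pow_ge0.
- by apply/measurable_EFinP; exact: measurable_funD.
rewrite (eq_integral (fun x =>
    ((`|lambda / n%:R| * `|f x|) ^+ n)%:E + (eta + eta)%:E)%E); last first.
  move=> x _; rewrite -!EFinD; congr EFin.
  by rewrite addrACA pos_part_powD// /c normrN.
rewrite ge0_integralD//; last 2 first.
- exact/measurable_EFinP.
- by move=> x _; rewrite lee_fin addr_ge0// ltW.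
rewrite leeD2l// [leLHS]integral_cst//.
rewrite [X in (_ * X)%E]muO -EFinM lee_fin /eta -splitr.
rewrite -mulrA ler_piMr ?(ltW e0)// mulrC ler_pdivrMr// mul1r.
by rewrite /M lerDl.
Qed.

(** The minimum of f over the closure is negative, hence interior, and the Hessian has trace >= 0
    there. So lambda f <= 0 with f < 0, which excludes lambda < 0. *)
Lemma eigenvalue_ge0 O f F H (lambda : R) :
  open O -> compact (closure O) -> C2_closure O f F H ->
  (forall x, O x -> - \tr (H x) = lambda * f x) ->
  (forall x, boundary O x -> f x = 0) ->
  (exists2 x, O x & f x < 0) -> 0 <= lambda.
Proof.
move=> oO cO C2f eqf f0 [x0 Ox0 fx0]; rewrite leNgt; apply/negP => l0.
have [x cx [xmin xin]] := exists_minimum 0 oO cO (ex_intro _ _ Ox0) C2f.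
have d0 (y : 'rV[R]_n) : dotrow y (0 : 'rV[R]_n) = 0.
  by rewrite /dotrow big1// => i _; rewrite mxE mulr0.
have fx : f x < 0.
  have := xmin x0 (subset_closure Ox0); rewrite !d0 !subr0 => h.
  exact: le_lt_trans fx0.
have [Ox|nOx] := pselect (O x); last first.
  by move: fx; rewrite f0 ?ltxx//; split=> //; rewrite ((interior_id O).1 oO).
have [_ psdH] := xin Ox.
have : 0 <= \tr (H x) by rewrite sumr_ge0// => i _; exact: psd_diag.
by rewrite -oppr_le0 eqf// leNgt (nmulr_rgt0 _ l0) fx.
Qed.

End integral_bound.

(** * Euclidean balls and the L^n norm *)

Section enorm_balls.
Variables (R : realType) (n : nat).
Notation mu := (lebesgue_row R n).

Lemma enormZ (c : R) (v : 'rV[R]_n) : enorm (c *: v) = `|c| * enorm v.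
Proof.
rewrite /enorm dotrowZl dotrowZr mulrA -expr2 sqrtrM ?sqr_ge0//.
by rewrite sqrtr_sqr.
Qed.

Lemma measurable_enorm_ball (r : R) : 0 < r -> measurable (enorm_ball (n := n) r).
Proof.
move=> r0.
have md : measurable_fun [set: 'rV[R]_n] (fun v => dotrow v v).
  apply: measurable_sum => i.
  by apply: measurable_funM; exact: measurable_row_coord.
have := measurable_preimage_row md (measurable_itv `]-oo, (r ^+ 2)%R[).
congr measurable; apply/seteqP; split => v;
  by rewrite /enorm_ball/= in_itv/= -enorm_sqr ltr_pXn2r// nnegrE ?enorm_ge0// ltW.
Qed.

Lemma lebesgue_row_unit_ball_le (r : R) : 0 < r ->
  (mu (unit_ball (n := n)) <= (r^-1 ^+ n)%:E * mu (enorm_ball (n := n) r))%E.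
Proof.
move=> r0; apply: lebesgue_row_scale.
- by rewrite invr_ge0 ltW.
- exact: measurable_enorm_ball.
- exact: (measurable_enorm_ball ltr01).
move=> v v1; exists (r *: v); last by rewrite scalerA mulVf ?scale1r// gt_eqF.
by rewrite /enorm_ball/= enormZ gtr0_norm// gtr_pMr.
Qed.

Lemma lebesgue_row_unit_ball_lty : (mu (unit_ball (n := n)) < +oo)%E.
Proof.
apply: (@lebesgue_row_ball_lty _ _ _ 1); first exact: (measurable_enorm_ball ltr01).
move=> v v1; apply/row_norm_leP => // i.
rewrite (le_trans _ (ltW v1))// -(@ler_pXn2r _ 2)// ?nnegrE ?enorm_ge0//.
rewrite enorm_sqr /dotrow (bigD1 i)//= -normrX ger0_norm ?sqr_ge0// expr2 lerDl.
by apply: sumr_ge0 => j _; rewrite -expr2 sqr_ge0.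
Qed.

Lemma Lnorm_patch (O : set 'rV[R]_n) (f : 'rV[R]_n -> R) : (0 < n)%N ->
  ('N[mu]_(n%:R%:E)[EFin \o (f \_ O)%R] =
   (\int[mu]_(x in O) (`|f x| ^+ n)%:E) `^ n%:R^-1)%E.
Proof.
move=> n0; rewrite unlock; congr (_ `^ _)%E; rewrite [RHS]integral_mkcond.
apply: eq_integral => x _; rewrite /= /patch; case: ifPn => _.
  by rewrite powR_mulrn.
by rewrite normr0 powR0// pnatr_eq0 -lt0n.
Qed.

End enorm_balls.

(** * The lower bound for the eigenvalue *)

Theorem corollary2p12 (R : realType) (n : nat) (n_gt0 : (0 < n)%N)
  (Omega : set 'rV[R]_n) (dom_Omega : bounded_domain Omega)
  (nu : 'rV[R]_n -> 'rV[R]_n) (nu_Omega : outward_unit_normal Omega nu)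
  (phi : 'rV[R]_n -> R) (lambda : R)
  (phi_C2 : Ck_on 2 Omega phi) (phi_C1 : C1_closure Omega phi)
  (phi_eigen : dirichlet_eigenfunction Omega lambda phi) :
  let mu := lebesgue_row R n in
  let m := inf [set enorm (gradient_closure Omega phi x) |
                x in boundary Omega] in
  (n%:R%:E * (mu (@unit_ball R n)) `^ n%:R^-1 *
     m%:E / 'N[mu]_(n%:R%:E)[EFin \o (phi \_ Omega)%R] <= lambda%:E)%E.
Proof.
cbv zeta; set mu := lebesgue_row R n; set m := inf _.
have [oO _ bO] := dom_Omega; have [C11 cphi [G cG GF]] := phi_C1.
have [eig bd [x0 Ox0 phix0]] := phi_eigen.
have cO := bounded_closure_compact bO.
have O0 : Omega !=set0 by exists x0.
have C2phi : C2_closure Omega phi (gradient phi) (hessian phi).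
  split=> //.
  - by move=> y Oy; exact: frechet_C1 C11 Oy.
  - by move=> x e Ox e0; exact: (frechet_gradient oO phi_C2 Ox e0).
  - by move=> x Ox; exact: (hessian_sym oO phi_C2 Ox).
have trH x : \tr (hessian phi x) = laplacian phi x.
  by apply: eq_bigr => i _; rewrite mxE.
have lambda0 : 0 <= lambda.
  (* The sign argument wants a negative value, taken by phi or by - phi at x0. *)
  have [phi0|phi0] : phi x0 < 0 \/ - phi x0 < 0.
    by move: phix0; rewrite neq_lt oppr_lt0 => /orP.
    apply: (eigenvalue_ge0 oO cO C2phi _ bd); last by exists x0.
    by move=> x Ox; rewrite trH eig.
  apply: (eigenvalue_ge0 oO cO (C2_closureN C2phi)); last by exists x0.
    by move=> x Ox; rewrite linearN/= trH eig// mulrN.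
  by move=> x bx; rewrite bd// oppr0.
have mG x : boundary Omega x -> m <= enorm (G x).
  move=> bx; apply: ge_inf; first by exists 0 => _ [y _ <-]; exact: enorm_ge0.
  by exists x => //; rewrite (gradient_closureE cG GF)//; case: bx.
rewrite Lnorm_patch//; set J := (\int[mu]_(x in Omega) _)%E.
have J0 : (0 <= J)%E.
  by apply: integral_ge0 => x _; rewrite lee_fin exprn_ge0.
have nR : 0 < n%:R :> R by rewrite ltr0n.
(* For m <= 0 the left side is at most 0 whatever the norm, zero included. *)
have [m0|m0] := leP m 0.
  apply: (@le_trans _ _ 0%E); last by rewrite lee_fin.
  apply: mule_le0_ge0; last by rewrite inve_ge0 poweR_ge0.
  by apply: mule_ge0_le0; [rewrite mule_ge0// poweR_ge0|rewrite lee_fin].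
have Ooo : (mu Omega < +oo)%E.
  have [M [Mreal OM]] := bO.
  apply: (@lebesgue_row_ball_lty _ _ _ (M + 1)); first exact: open_measurable_row.
  by move=> v Ov; apply: (OM (M + 1)); rewrite ?ltrDl.
have cf x : Omega x -> {for x, continuous phi} by have [+ _] := phi_C2; exact.
have trE x : Omega x -> - \tr (hessian phi x) = lambda * phi x.
  by move=> Ox; rewrite trH eig.
have := abp_bound n_gt0 oO cO O0 Ooo nu_Omega C2phi cf trE cG GF bd mG
  (measurable_enorm_ball m0).
rewrite (eq_integral (fun x =>
    ((lambda / n%:R) ^+ n)%:E * (`|phi x| ^+ n)%:E)%E); last first.
  by move=> x _; rewrite -EFinM -exprMn ger0_norm// divr_ge0// ltW.
rewrite ge0_integralZl//; last 3 first.
- exact: open_measurable_row.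
- apply/measurable_EFinP; apply: measurable_funX.
  by apply: measurableT_comp => //; exact: open_continuous_measurable.
- by rewrite lee_fin exprn_ge0// divr_ge0// ltW.
rewrite -/J => ball_le.
have := lebesgue_row_unit_ball_le n m0.
have := lebesgue_row_unit_ball_lty R n; rewrite -/mu.
have : (0 <= mu (@unit_ball R n))%E by exact: measure_ge0.
move: (mu (@unit_ball R n)) => b.
case: b => [b||]//; rewrite lee_fin => b0 _ bm.
case: J J0 ball_le => [j||]//; last first.
  (* An infinite norm has inverse 0, and the claim reduces to lambda >= 0. *)
  move=> _ _; rewrite poweRyr ?gt_eqF ?invr_gt0// invey mule0 lee_fin//.
rewrite lee_fin => j0 ball_le.
have {bm} : b <= (m^-1 * (lambda / n%:R)) ^+ n * j.
  rewrite -lee_fin; apply: (le_trans bm).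
  rewrite exprMn -mulrA EFinM lee_wpmul2l//.
  by rewrite lee_fin exprn_ge0// invr_ge0 ltW.
move=> bj; rewrite !poweR_EFin.
have k0 : 0 <= m^-1 * (lambda / n%:R) by rewrite mulr_ge0 ?invr_ge0 ?divr_ge0// ltW.
have {bj} bj : b `^ n%:R^-1 <= m^-1 * (lambda / n%:R) * j `^ n%:R^-1.
  apply: (@le_trans _ _ (((m^-1 * (lambda / n%:R)) ^+ n * j) `^ n%:R^-1)).
    by apply: ge0_ler_powR => //; rewrite ?nnegrE ?invr_ge0 ?mulr_ge0 ?exprn_ge0// ltW.
  rewrite powRM ?exprn_ge0// -powR_mulrn// -powRrM mulfV ?gt_eqF// powRr1//.
(* A zero norm would force the unit ball to have measure 0; the left side is then 0 times the
   inverse of the norm, that is 0. *)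
have [j_eq0|j_gt0] := eqVneq j 0.
  have b_eq0 : b `^ n%:R^-1 = 0.
    apply/eqP; rewrite eq_le powR_ge0 andbT (le_trans bj)// j_eq0 powR0 ?mulr0//.
    by rewrite gt_eqF// invr_gt0.
  by rewrite b_eq0 mule0 !mul0e lee_fin.
have s0 : 0 < j `^ n%:R^-1 by rewrite powR_gt0// lt_neqAle eq_sym j_gt0.
rewrite inver gt_eqF// -!EFinM lee_fin ler_pdivrMr//.
have := ler_wpM2l (ltW (mulr_gt0 nR m0)) bj.
have -> : n%:R * m * (m^-1 * (lambda / n%:R) * j `^ n%:R^-1) = lambda * j `^ n%:R^-1.
  by field; rewrite !gt_eqF.
by rewrite mulrAC.
Qed.
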